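(* Consider any tree-shaped network of strings (with edges of length $1$ and wave speeds $c_i>0$), with transparent boundary conditions at all external nodes, and with the continuity conditions and the modified Kirchhoff law at all internal nodes. Suppose that at each internal node $n$, connecting $k$ edges, the coefficient of the damping term in the modified Kirchhoff law is $\alpha(n)=k-2$. Then each solution of the wave equation on the network becomes constant after some finite time: there exist $T\ge 0$ and a constant $C\in\mathbb{R}$ such that $u_i(x,t)=C$ for every edge $i$, all $x\in[0,1]$ and all $t\ge T$.
   Context: Network. Let $\mathcal T$ be a finite tree with nodes $n\in\mathcal N=\{0,\dots,N\}$ and edges $i\in\mathcal I=\{1,\dots,N\}$. The node $0$ is an external (simple, i.e. degree one) node called the root; edges are oriented away from the root. Each edge has length $1$ and is parametrized by $x\in[0,1]$, $x=0$ being its initial point and $x=1$ its final point. The numbering is such that edge $i$ has node $i$ as final point, and edge $1$ has the root as initial point. $\mathcal N_S$ and $\mathcal N_M$ denote the sets of simple (degree one, external) and multiple (internal) nodes. For $n\in\mathcal N_M$, $\mathcal I_n$ is the set of edges having node $n$ as initial point, and $k_n=\#\mathcal I_n+1\ge 2$ is the number of edges meeting at $n$ (degree-two internal nodes are allowed). The constants $c_i>0$, $i\in\mathcal I$, are given. Equations. On each edge, $u_{i,tt}-c_i^2u_{i,xx}=0$ for $t>0$, $0<x<1$. Transparent conditions at external nodes: $c_nu_{n,x}(1,t)=-u_{n,t}(1,t)$ for $n\in\mathcal N_S\setminus\{0\}$, and $c_1u_{1,x}(0,t)=u_{1,t}(0,t)$ at the root. Continuity at internal nodes: $u_i(0,t)=u_n(1,t)$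 for $n\in\mathcal N_M$, $i\in\mathcal I_n$. Modified Kirchhoff law at internal nodes: $\sum_{i\in\mathcal I_n}c_iu_{i,x}(0,t)-c_nu_{n,x}(1,t)=-\alpha(n)u_{n,t}(1,t)$ for $n\in\mathcal N_M$. Solutions. The initial data $(u_i^0,u_i^1)_{i\in\mathcal I}=(u_i(\cdot,0),u_{i,t}(\cdot,0))_{i\in\mathcal I}$ are taken in $$\mathcal H=\Big\{(u_i,v_i)_{i\in\mathcal I}\in\prod_{i\in\mathcal I}[H^1(0,1)\times L^2(0,1)]:\ u_i(0)=u_n(1)\ \forall n\in\mathcal N_M,\ \forall i\in\mathcal I_n\Big\},$$ and solutions are (weak) solutions with $(u_i,u_{i,t})_{i\in\mathcal I}\in C([0,\infty);\mathcal H)$, i.e. the trajectories of the strongly continuous semigroup on $\mathcal H$ generated by $(u_i,v_i)_i\mapsto(v_i,c_i^2u_{i,xx})_i$ with domain the set of $(u_i,v_i)_i\in\prod_i[H^2(0,1)\times H^1(0,1)]$ satisfying $c_nu_{n,x}(1)=-v_n(1)$ for $n\in\mathcal N_S\setminus\{0\}$, $c_1u_{1,x}(0)=v_1(0)$, $u_i(0)=u_n(1)$ for $n\in\mathcal N_M$, $i\in\mathcal I_n$, $\sum_{i\in\mathcal I_n}c_iu_{i,x}(0)-c_nu_{n,x}(1)=-\alpha(n)v_n(1)$ for $n\in\mathcal N_M$, and $v_i(0)=v_n(1)$ for $n\in\mathcal N_M$, $i\in\mathcal I_n$. *)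

(* Defs.v *)
From mathcomp Require Import all_boot all_order all_algebra.
From mathcomp Require Import all_classical all_reals all_analysis.
Set Implicit Arguments.
Unset Strict Implicit.
Unset Printing Implicit Defensive.
Import Order.TTheory GRing.Theory Num.Theory.
Import numFieldNormedType.Exports.

Local Open Scope classical_set_scope.
Local Open Scope ring_scope.

Section Sobolev.
Context {R : realType}.
Implicit Types u f g phi : R -> R.

Definition L2 f : Prop :=
  f \_ `]0%R, 1%R[ \in Lfun (@lebesgue_measure R) 2%:E.

Definition normL2 f : R :=
  fine ('N[@lebesgue_measure R]_2%:E [EFin \o (f \_ `]0%R, 1%R[)])%E.

(* Test functions: C^1, with compact support contained in (0, 1). *)
Definition test_function phi : Prop :=
  [/\ (forall x, derivable phi x 1), continuous (derive1 phi) &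
      exists a b : R, [/\ 0 < a, b < 1 &
        forall x, phi x != 0 -> a <= x <= b]].

Definition is_wderiv u g : Prop :=
  [/\ L2 u, L2 g & forall phi, test_function phi ->
      \int[lebesgue_measure]_(x in `]0%R, 1%R[) (u x * derive1 phi x) =
      - \int[lebesgue_measure]_(x in `]0%R, 1%R[) (g x * phi x)].

(* An element of H^1(0, 1) is given by its representative continuous on
   [0, 1], so that u 0 and u 1 are the traces; the values of u outside [0, 1]
   are irrelevant. *)
Definition H1 u : Prop :=
  {within `[0%R, 1%R], continuous u} /\ exists g, is_wderiv u g.

(* Unique up to equality a.e. on (0, 1). *)
Definition wderiv u : R -> R := xget (cst 0) [set g | is_wderiv u g].

End Sobolev.

(* Strongly continuous semigroups on the normed space obtained from a linear
   subspace H of E by identifying x and y when N (x - y) = 0, where N is a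
   seminorm on H. *)
Section Semigroup.
Context {R : realType} {E : lmodType R}.
Variables (H : set E) (N : E -> R).

Definition same (x y : E) : Prop := N (x - y) = 0.

Record C0_semigroup (S : R -> E -> E) : Prop := {
  C0_stable : forall (t : R) x, 0 <= t -> H x -> H (S t x);
  C0_linear : forall (t a : R) x y, 0 <= t -> H x -> H y ->
    same (S t (a *: x + y)) (a *: S t x + S t y);
  C0_bounded : forall t : R, 0 <= t ->
    exists M, forall x, H x -> N (S t x) <= M * N x;
  C0_id : forall x, H x -> same (S 0 x) x;
  C0_add : forall (s t : R) x, 0 <= s -> 0 <= t -> H x ->
    same (S (s + t) x) (S s (S t x));
  C0_continuous : forall x, H x -> N (S t x - x) @[t --> 0^'+] --> (0 : R)
}.

Definition generator (S : R -> E -> E) (x y : E) : Prop :=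
  [/\ H x, H y & N (t^-1 *: (S t x - x) - y) @[t --> 0^'+] --> (0 : R)].

Definition trajectory (S : R -> E -> E) (U : R -> E) : Prop :=
  forall t : R, 0 <= t -> H (U t) /\ same (U t) (S t (U 0)).

End Semigroup.

(* Nodes 0, ..., n+1 are 'I_n.+2 and edges 1, ..., n+1 are 'I_n.+1: the edge
   numbered i + 1 is i : 'I_n.+1, and its final point is the node i + 1.  A
   network is given by the initial points of its edges. *)
Section Network.
Context {n : nat}.
Variable init : 'I_n.+1 -> 'I_n.+2.

Definition final (i : 'I_n.+1) : 'I_n.+2 := lift ord0 i.

Definition arc : rel 'I_n.+2 :=
  fun x y => [exists i, (init i == x) && (final i == y)].

Definition adj : rel 'I_n.+2 := fun x y => arc x y || arc y x.

Definition is_tree : Prop :=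
  [/\ irreflexive adj, (forall x y, connect adj x y) &
      forall p, ucycle adj p -> (size p <= 2)%N].

Definition degree (x : 'I_n.+2) : nat :=
  #|[set i | (init i == x) || (final i == x)]|.

Definition simple_node (x : 'I_n.+2) : bool := degree x == 1%N.
Definition multiple_node (x : 'I_n.+2) : bool := (1 < degree x)%N.

(* Orientation away from the root: every node is the end of a directed path
   starting at the root. *)
Record tree_network : Prop := {
  network_tree : is_tree;
  network_root_simple : simple_node ord0;
  network_first_edge : init ord0 = ord0;
  network_oriented : forall x, connect arc ord0 x
}.

End Network.

Section WaveEquation.
Context {R : realType} {n : nat}.
Variables (init : 'I_n.+1 -> 'I_n.+2) (c : 'I_n.+1 -> R) (alpha : 'I_n.+2 -> R).

Definition state : Type :=
  (('I_n.+1 -> R -> R) * ('I_n.+1 -> R -> R))%type.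

(* w j 0 = w i 1 whenever the edge j starts at the internal node where the
   edge i ends. *)
Definition continuous_at_nodes (w : 'I_n.+1 -> R -> R) : Prop :=
  forall i j, multiple_node init (final i) -> init j = final i ->
    w j 0 = w i 1.

Definition stateH : set state :=
  [set U | [/\ forall i, H1 (U.1 i), forall i, L2 (U.2 i) &
               continuous_at_nodes U.1]].

Definition normH (U : state) : R :=
  Num.sqrt (\sum_i (normL2 (U.1 i) ^+ 2 + normL2 (wderiv (U.1 i)) ^+ 2
                    + normL2 (U.2 i) ^+ 2)).

(* (u, v) is in the domain of the wave operator, v being represented by
   continuous functions, and ux and uxx are the first and second derivatives
   of u. *)
Definition wave_domain (u v ux uxx : 'I_n.+1 -> R -> R) : Prop :=
  [/\ forall i, [/\ H1 (u i), is_wderiv (u i) (ux i), H1 (ux i),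
                    is_wderiv (ux i) (uxx i) & H1 (v i)],
      continuous_at_nodes u /\ continuous_at_nodes v,
      forall i, simple_node init (final i) -> c i * ux i 1 = - v i 1,
      c ord0 * ux ord0 0 = v ord0 0 &
      forall i, multiple_node init (final i) ->
        \sum_(j | init j == final i) c j * ux j 0 - c i * ux i 1 =
        - alpha (final i) * v i 1].

(* The graph of (u, v) |-> (v, c^2 u_xx), closed under equality in H. *)
Definition wave_operator (U W : state) : Prop :=
  exists u v ux uxx, [/\ wave_domain u v ux uxx,
    same normH U (u, v) &
    same normH W (v, fun i x => c i ^+ 2 * uxx i x)].

Definition wave_solution (U : R -> state) : Prop :=
  exists2 S : R -> state -> state,
    C0_semigroup stateH normH S /\
    (forall U0 W, stateH U0 -> stateH W ->
       generator stateH normH S U0 W <-> wave_operator U0 W) &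
    trajectory stateH normH S U.

End WaveEquation.

Arguments state : clear implicits.

(* Main.v *)
Require Import Defs.
From mathcomp Require Import all_boot all_order all_algebra.
From mathcomp Require Import all_classical all_reals all_analysis.
From mathcomp Require Import measurable_realfun ring lra.
Set Implicit Arguments.
Unset Strict Implicit.
Unset Printing Implicit Defensive.
Import Order.TTheory GRing.Theory Num.Theory.
Import numFieldNormedType.Exports.
Local Open Scope classical_set_scope.
Local Open Scope ring_scope.

(** Write v = u_t.  On an edge of wave speed c the solution splits into the two
Riemann invariants v - c u_x and v + c u_x, which travel unchanged at speed c,
the first away from the root and the second towards it.  Let w be the common
velocity at an internal node of degree k.  Adding the k invariants that arrive
at the node and using the Kirchhoff law gives k w - alpha w, which is 2 w when
alpha = k - 2.  On each edge the invariant leaving the node and the invariant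
arriving at it also add up to 2 w.  Hence the invariant that leaves along an
edge is the sum of those that arrive along the other edges: nothing is
reflected.  Nothing is reflected at the external nodes either, so signals never
turn back.  In a tree a signal that does not turn back moves towards the root
for a while, then away from it, and leaves the network within a bounded time.
After that time v = u_x = 0, so that u is constant in space and time.

The computations at the nodes are [no_inflow_up] and [no_inflow_down], the
transport along an edge is [riemann_eq0].  Silence spreads first through the
invariants moving towards the root, by decreasing depth ([quiet_up]), then
through the others, by increasing depth ([quiet_down]).

A weak solution is only known as an orbit of the semigroup.  For data in the
domain of the generator the orbit stays in the domain, solves the equations in
the strong sense at each time, and has a right derivative in time.  The
invariants themselves are not continuous functionals of the state, so one
follows their integrals over a part of an edge ([riemann]), whose upper bound p
moves with the characteristic: these are bounded linear functionals that are
Hoelder continuous in p, and their right derivative along the motion vanishes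
when nothing enters the edge ([moving_functional]).  A continuous function with
zero right derivative is constant.  Continuity of the orbits from the left does
not come with the definition of the semigroup: right continuity and Baire's
theorem give a time of continuity in every interval, and the boundedness of each
operator propagates continuity from there to all later times ([S_continuous]).
Lastly, the conclusion is a closed condition on the data, and the domain is
dense ([domain_dense]), because C^1 functions vanishing at both ends are dense
in L^2(0, 1) ([L2_approx0]). *)

(** * Square-integrable functions on (0, 1) *)
Section L2.
Context {R : realType}.
Implicit Types (f g u phi : R -> R) (a b x : R).
Local Notation mu := (@lebesgue_measure R).
Local Notation I := (`]0%R, 1%R[%classic : set R).

Definition sqL2 f : R := \int[mu]_(x in I) (f x ^+ 2).

Lemma mI : measurable (I : set (measurableTypeR R)).
Proof. exact: measurable_itv. Qed.

Lemma muI : mu I = 1%:E.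
Proof. by rewrite lebesgue_measure_itv/= lte_fin ltr01 oppr0 adde0. Qed.

Lemma muI_lty : (mu I < +oo)%E. Proof. by rewrite muI ltry. Qed.

Lemma integrable_add (J : set R) f g : measurable (J : set (measurableTypeR R)) ->
  mu.-integrable J (EFin \o f) -> mu.-integrable J (EFin \o g) ->
  mu.-integrable J (EFin \o (fun x => f x + g x)).
Proof. by move=> mJ If Ig; apply: eq_integrable (integrableD mJ If Ig). Qed.

Lemma integrable_scale (J : set R) a f : measurable (J : set (measurableTypeR R)) ->
  mu.-integrable J (EFin \o f) -> mu.-integrable J (EFin \o (fun x => a * f x)).
Proof. by move=> mJ If; apply: eq_integrable (integrableZl mJ a If). Qed.

Lemma L2P f : L2 f <-> measurable_fun I f /\
  mu.-integrable I (EFin \o (fun x => f x ^+ 2)).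
Proof.
rewrite /L2; split.
- move=> /[dup] Lf /Lfun2_integrable_sqr Hi; split.
    move: Lf; rewrite inE => /andP[/[!inE]/= mf _].
    by apply/(measurable_restrictT _ mI).
  rewrite -[X in integrable mu X _]setTI.
  apply/(integrable_restrict mu mI measurableT).
  apply: eq_integrable Hi => // x _ /=.
  by rewrite patchE /= patchE; case: ifP; rewrite ?expr0n.
- move=> [mf Hi]; rewrite inE; apply/andP; split; rewrite inE /=.
    by apply/(measurable_restrictT _ mI).
  rewrite /finite_norm unlock /Lnorm poweR_lty//.
  have /(integrableP) [_] := Hi.
  rewrite [in X in (X < _)%E -> _]integral_mkcond.
  rewrite (_ : integral _ _ _ = integral mu setT (fun x => (`|(f \_ I) x| `^ 2)%:E))//.
  apply: eq_integral => x _; rewrite /= !patchE; case: ifP => _ /=.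
    by rewrite powR_mulrn// ?real_normK ?num_real// ger0_norm ?sqr_ge0.
  by rewrite normr0 powR0// pnatr_eq0.
Qed.

(** Norms enter all estimates through their squares, which are plain
integrals. *)
Lemma normL2E f : L2 f -> normL2 f ^+ 2 = sqL2 f.
Proof.
move=> /[dup] Lf /L2P[mf Hi].
have fin : ('N[mu]_2%:E[EFin \o (f \_ I)] < +oo)%E.
  by move: Lf; rewrite /L2 inE => /andP[_]; rewrite inE.
rewrite /sqL2 /Rintegral /normL2.
have := @powR_Lnorm _ _ _ mu (EFin \o (f \_ I)) 2 ltac:(by rewrite pnatr_eq0).
have -> : (\int[mu]_x `|(EFin \o (f \_ I)) x| `^ 2 = \int[mu]_(x in I) (f x ^+ 2)%:E)%E.
  rewrite [in RHS]integral_mkcond.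
  apply: eq_integral => x _; rewrite /= patchE patchE; case: ifP => _ /=.
    by rewrite powR_mulrn// ?real_normK ?num_real// ger0_norm ?sqr_ge0.
  by rewrite normr0 powR0// pnatr_eq0.
move=> <-.
have N0 := Lnorm_ge0 mu 2%:E (EFin \o (f \_ I)).
by rewrite fine_poweR powR_mulrn// fine_ge0.
Qed.

Lemma L2_measurable f : L2 f -> measurable_fun I f.
Proof. by move/L2P => []. Qed.

Lemma L2_sqr_integrable f : L2 f -> mu.-integrable I (EFin \o (fun x => f x ^+ 2)).
Proof. by move/L2P => []. Qed.

Lemma L2_bounded f M : measurable_fun I f -> (forall x, I x -> `|f x| <= M) -> L2 f.
Proof.
move=> mf fM; apply/L2P; split => //.
apply: (@measurable_bounded_integrable _ _ _ mu) => //.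
- exact: muI_lty.
- exact: measurable_funX.
- exists (M ^+ 2); split; first exact: num_real.
  move=> y My x Ix /=.
  rewrite normrX (le_trans _ (ltW My))// lerXn2r ?nnegrE ?fM//.
  by rewrite (le_trans _ (fM _ Ix)).
Qed.

Lemma L2_cst (a : R) : L2 (cst a).
Proof. by apply: (@L2_bounded _ `|a|) => //; exact: measurable_cst. Qed.

Lemma L2_mul_integrable f g : L2 f -> L2 g ->
  mu.-integrable I (EFin \o (fun x => f x * g x)).
Proof.
move=> Lf Lg.
have h := integrableD mI (L2_sqr_integrable Lf) (L2_sqr_integrable Lg).
apply: le_integrable h => //.
  apply/measurable_EFinP; apply: measurable_funM; exact: L2_measurable.
move=> x Ix /=; rewrite lee_fin.
rewrite [leRHS]ger0_norm ?addr_ge0 ?sqr_ge0//.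
rewrite normrM -(real_normK (num_real (f x))) -(real_normK (num_real (g x))).
have := sqr_ge0 (`|f x| - `|g x|); rewrite sqrrB => h'.
have := normr_ge0 (f x); have := normr_ge0 (g x); nra.
Qed.

Lemma L2_integrable f : L2 f -> mu.-integrable I (EFin \o f).
Proof.
move=> Lf; have := L2_mul_integrable Lf (L2_cst 1).
by apply: eq_integrable => // x _ /=; rewrite mulr1.
Qed.

Lemma L2D f g : L2 f -> L2 g -> L2 (fun x => f x + g x).
Proof.
move=> Lf Lg; apply/L2P; split.
  by apply: measurable_funD; exact: L2_measurable.
have h := integrableD mI (L2_sqr_integrable Lf) (L2_sqr_integrable Lg).
have h2 := integrableD mI h (integrableZl mI 2 (L2_mul_integrable Lf Lg)).
by apply: eq_integrable h2 => // x _ /=; congr (_%:E); ring.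
Qed.

Lemma L2Z a f : L2 f -> L2 (fun x => a * f x).
Proof.
move=> Lf; apply/L2P; split.
  apply: measurable_funM => //; exact: L2_measurable.
have h := integrableZl mI (a ^+ 2) (L2_sqr_integrable Lf).
by apply: eq_integrable h => // x _ /=; congr (_%:E); ring.
Qed.

Lemma L2_eq f g : (forall x, I x -> f x = g x) -> L2 f -> L2 g.
Proof.
move=> fg /L2P[mf sf]; apply/L2P; split.
  apply: eq_measurable_fun mf => x; rewrite inE; exact: fg.
by apply: eq_integrable sf => // x /[!inE] Ix /=; rewrite fg.
Qed.

Lemma L2B f g : L2 f -> L2 g -> L2 (fun x => f x - g x).
Proof.
move=> Lf Lg; apply: L2_eq (L2D Lf (L2Z (-1) Lg)) => x _; by rewrite mulN1r.
Qed.

Lemma sqL2_ge0 f : 0 <= sqL2 f.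
Proof. by apply: Rintegral_ge0 => x _; exact: sqr_ge0. Qed.

Lemma eq_sqL2 f g : (forall x, I x -> f x = g x) -> sqL2 f = sqL2 g.
Proof. by move=> fg; apply: eq_Rintegral => x /[!inE] /fg ->. Qed.

Lemma sqL2D f g : L2 f -> L2 g ->
  sqL2 (fun x => f x + g x) <= 2 * (sqL2 f + sqL2 g).
Proof.
move=> Lf Lg.
have f2 := L2_sqr_integrable Lf; have g2 := L2_sqr_integrable Lg.
rewrite /sqL2 -RintegralD// -RintegralZl//; last exact: integrable_add.
apply: le_Rintegral => //.
- exact: L2_sqr_integrable (L2D Lf Lg).
- exact/integrable_scale/integrable_add.
- move=> x _; have := sqr_ge0 (f x - g x); nra.
Qed.

Lemma sqL2Z a f : L2 f -> sqL2 (fun x => a * f x) = a ^+ 2 * sqL2 f.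
Proof.
move=> Lf; rewrite /sqL2 -RintegralZl//; last exact: L2_sqr_integrable.
by apply: eq_Rintegral => x _; rewrite exprMn.
Qed.

Definition prim f x : R := \int[mu]_(t in `]0%R, x[) f t.

Lemma prim0 f : prim f 0 = 0.
Proof. by rewrite /prim set_itv_ge ?Rintegral_set0// -leNgt bnd_simp. Qed.

Lemma L2_integrable_sub f (J : set R) : L2 f -> measurable J -> J `<=` I ->
  mu.-integrable J (EFin \o f).
Proof. by move=> Lf mJ JI; apply: integrableS (L2_integrable Lf). Qed.

Lemma itv_subI a b : 0 <= a -> b <= 1 -> `]a, b[%classic `<=` I.
Proof.
move=> a0 b1 x /=; rewrite !in_itv/= => /andP[ax xb].
by rewrite (le_lt_trans a0)//= (lt_le_trans xb).
Qed.

Lemma primB f a b : L2 f -> 0 <= a -> a <= b -> b <= 1 ->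
  prim f b - prim f a = \int[mu]_(t in `]a, b[) f t.
Proof.
move=> Lf a0 ab b1.
have Hi c d : 0 <= c -> d <= 1 -> mu.-integrable `]c, d[ (EFin \o f).
  by move=> c0 d1; apply: L2_integrable_sub => //; exact: itv_subI.
have [->|a_neq0] := eqVneq a 0; first by rewrite prim0 subr0.
rewrite /prim.
have [<-|a_neqb] := eqVneq a b.
  by rewrite subrr set_itv_ge ?Rintegral_set0// -leNgt bnd_simp.
have a_gt0 : 0 < a by rewrite lt_neqAle eq_sym a_neq0.
have ab' : a < b by rewrite lt_neqAle a_neqb.
have Hic : mu.-integrable `]0, a] (EFin \o f).
  apply: integrableS (Hi 0 b _ _) => //; apply: subset_itvl; by rewrite bnd_simp.
rewrite [X in _ - X = _]Rintegral_itv_bndo_bndc//; last by apply: Hi => //; lra.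
by rewrite Rintegral_itvB// ?bnd_simp//; exact: Hi.
Qed.

Lemma primD f g x : L2 f -> L2 g -> x <= 1 ->
  prim (fun t => f t + g t) x = prim f x + prim g x.
Proof.
move=> Lf Lg x1; rewrite /prim RintegralD//;
  by apply: L2_integrable_sub => //; exact: itv_subI.
Qed.

Lemma primZ f a x : L2 f -> x <= 1 -> prim (fun t => a * f t) x = a * prim f x.
Proof.
move=> Lf x1; rewrite /prim RintegralZl//.
by apply: L2_integrable_sub => //; exact: itv_subI.
Qed.

(** The Cauchy-Schwarz inequality against 1.  The factor b - a is what makes
integrals of a state over a short segment small. *)
Lemma sqr_Rintegral_le f a b : L2 f -> 0 <= a -> a <= b -> b <= 1 ->
  (\int[mu]_(t in `]a, b[) f t) ^+ 2 <= (b - a) * sqL2 f.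
Proof.
move=> Lf a0 ab b1.
have [<-|a_neqb] := eqVneq a b.
  rewrite subrr mul0r set_itv_ge ?Rintegral_set0 ?expr0n//.
  by rewrite -leNgt bnd_simp.
have ab' : a < b by rewrite lt_neqAle a_neqb.
have sub := itv_subI a0 b1.
have mJ : measurable `]a, b[%classic by exact: measurable_itv.
set J := `]a, b[%classic in sub mJ *.
pose m := (\int[mu]_(t in J) f t) / (b - a).
have ba0 : b - a != 0 by rewrite subr_eq0 gt_eqF.
have intf : \int[mu]_(t in J) f t = m * (b - a) by rewrite /m divfK.
have fJ : mu.-integrable J (EFin \o f) by exact: L2_integrable_sub.
have f2J : mu.-integrable J (EFin \o (fun x => f x ^+ 2)).
  exact: integrableS (L2_sqr_integrable Lf).
have intc c : \int[mu]_(t in J) c = c * (b - a).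
  have muJ : mu J = (b - a)%:E.
    by rewrite /J lebesgue_measure_itv/= lte_fin ab' EFinB.
  by rewrite Rintegral_cst//; congr (_ * _); exact: (congr1 fine muJ).
have cJ c : mu.-integrable J (EFin \o cst c).
  exact: L2_integrable_sub (L2_cst c) mJ sub.
have le1 : \int[mu]_(t in J) (f t ^+ 2) <= sqL2 f.
  rewrite /sqL2 /Rintegral fine_le//.
  - exact: integrable_fin_num f2J.
  - exact: integrable_fin_num (L2_sqr_integrable Lf).
  apply: ge0_subset_integral => //.
  - apply/measurable_EFinP; apply: measurable_funX; exact: L2_measurable.
  - by move=> x _; rewrite lee_fin sqr_ge0.
(* The variance of f around its mean m is nonnegative. *)
have ge0 : 0 <= \int[mu]_(t in J) (f t ^+ 2 + ((- 2 * m) * f t + m ^+ 2)).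
  apply: Rintegral_ge0 => x _; have := sqr_ge0 (f x - m); nra.
move: ge0; rewrite RintegralD//; last first.
  by apply: integrable_add => //; [exact: integrable_scale|exact: cJ].
rewrite RintegralD//; [|exact: integrable_scale|exact: cJ].
rewrite RintegralZl// intc intf.
move: le1; set S := \int[mu]_(t in J) _; set L := b - a => SL S0.
have -> : (m * L) ^+ 2 = L * (m ^+ 2 * L) by ring.
apply: ler_wpM2l; first by rewrite subr_ge0.
apply: le_trans SL; rewrite -subr_ge0.
by apply: le_trans S0 _; rewrite le_eqVlt; apply/orP; left; apply/eqP; ring.
Qed.

Lemma sqr_primB_le f a b : L2 f -> 0 <= a <= 1 -> 0 <= b <= 1 ->
  (prim f b - prim f a) ^+ 2 <= `|b - a| * sqL2 f.
Proof.
move=> Lf /andP[a0 a1] /andP[b0 b1].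
have [ab|/ltW ba] := leP a b.
  by rewrite primB// ger0_norm ?subr_ge0// sqr_Rintegral_le.
rewrite distrC ger0_norm ?subr_ge0// -sqrrN opprB primB//.
exact: sqr_Rintegral_le.
Qed.
End L2.

(** * Weak derivatives: the fundamental theorem of calculus *)
Section Sobolev.
Context {R : realType}.
Implicit Types (f g u phi : R -> R) (a b x : R).
Local Notation mu := (@lebesgue_measure R).
Local Notation I := (`]0%R, 1%R[%classic : set R).

Lemma Rintegral_dominated (f_ : nat -> R -> R) f G :
  (forall n, measurable_fun I (f_ n)) -> measurable_fun I f ->
  {ae mu, forall x, I x -> f_ n x @[n --> \oo] --> f x} ->
  mu.-integrable I (EFin \o G) ->
  (forall n x, I x -> `|f_ n x| <= G x) ->
  \int[mu]_(x in I) f_ n x @[n --> \oo] --> \int[mu]_(x in I) f x.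
Proof.
move=> mf_ mf cf iG fG.
have [||||| If _ cvI] := @dominated_convergence _ _ _ mu I mI
  (fun n => EFin \o f_ n) (EFin \o f) (EFin \o G).
- by move=> n; apply/measurable_EFinP; exact: mf_.
- by apply/measurable_EFinP.
- move: cf; apply: filterS; first exact: (ae_filter_ringOfSetsType mu).
  by move=> x cfx Ix; apply: cvg_EFin; [exact: nearW|exact: cfx].
- exact: iG.
- by apply: aeW => x n Ix /=; rewrite lee_fin; exact: fG.
apply: fine_cvg.
have -> : (\int[mu]_(x in I) f x)%:E = (\int[mu]_(x in I) (EFin \o f) x)%E.
  by rewrite fineK//; exact: integrable_fin_num If.
exact: cvI.
Qed.

(** The square of the positive part of t, written so that its derivative
t + |t| is a formula without case distinction. *)
Definition sqrp (t : R) : R := (t ^+ 2 + t * `|t|) / 2.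
(** A quadratic spline rising from 0 at t = 0 to 1 at t = 1.  It is C^1,
the regularity required of test functions. *)
Definition ramp (t : R) : R := 2 * (sqrp t - 2 * sqrp (t - 2^-1) + sqrp (t - 1)).
Definition ramp' (t : R) : R :=
  2 * ((t + `|t|) - 2 * (t - 2^-1 + `|t - 2^-1|) + (t - 1 + `|t - 1|)).

(** A Taylor bound that holds globally is stable under sums and shifts, which
spares the study of the spline at its knots. *)
Lemma is_derive_quadratic f x (d K : R) :
  (forall h, `|f (x + h) - f x - h * d| <= K * h ^+ 2) -> is_derive x 1 f d.
Proof.
move=> fK.
have K0 : 0 <= K by have := fK 1; rewrite expr1n mulr1; apply: le_trans.
suff cv : h^-1 *: (f (h *: (1 : R) + x) - f x) @[h --> 0^'] --> d.
  apply: DeriveDef; first by apply/cvg_ex; exists d.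
  exact/cvg_lim.
apply/cvgrPdist_le => e e0.
have d0 : 0 < e / (K + 1) by rewrite divr_gt0// ltr_wpDl.
near=> h.
have h0 : h != 0 by near: h; exact: nbhs_dnbhs_neq.
have hd : `|h| < e / (K + 1) by near: h; apply: dnbhs0_lt.
rewrite distrC [h *: _]mulr1 (addrC h).
have -> : h^-1 *: (f (x + h) - f x) - d = h^-1 * (f (x + h) - f x - h * d).
  by rewrite mulrBr mulKf.
rewrite normrM normfV ler_pdivrMl ?normr_gt0//.
apply: (le_trans (fK h)); rewrite -real_normK ?num_real// expr2 mulrCA.
apply: ler_wpM2l => //.
move: hd; rewrite ltr_pdivlMr ?ltr_wpDl// => hd.
have := normr_ge0 h; nra.
Unshelve. all: by end_near. Qed.

Lemma is_derive_continuous f x d : is_derive x 1 f d -> {for x, continuous f}.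
Proof. by move=> [df _]; apply: differentiable_continuous; apply/derivable1_diffP. Qed.

Lemma sqrp_quadratic (t h : R) : `|sqrp (t + h) - sqrp t - h * (t + `|t|)| <= h ^+ 2.
Proof.
rewrite /sqrp; have [t0|t0] := ger0P t; have [th0|th0] := ger0P (t + h);
  have h2 := sqr_ge0 h; have th2 := sqr_ge0 (t + h).
- rewrite [X in `|X|](_ : _ = h ^+ 2); last by field.
  by rewrite ger0_norm.
- rewrite [X in `|X|](_ : _ = h ^+ 2 - (t + h) ^+ 2); last by field.
  by rewrite ler_norml; apply/andP; split; nra.
- rewrite [X in `|X|](_ : _ = (t + h) ^+ 2); last by field.
  by rewrite ger0_norm//; nra.
- by rewrite [X in `|X|](_ : _ = 0) ?normr0//; field.
Qed.

Lemma ramp_le0 (t : R) : t <= 0 -> ramp t = 0.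
Proof.
move=> t0; rewrite /ramp /sqrp !ler0_norm; try lra; by field.
Qed.

Lemma ramp_ge1 (t : R) : 1 <= t -> ramp t = 1.
Proof.
by move=> t1; rewrite /ramp /sqrp !ger0_norm; try lra; field.
Qed.

Lemma ramp_itv (t : R) : 0 <= ramp t <= 1.
Proof.
have [/ramp_le0 ->|t0] := leP t 0; first by rewrite lexx ler01.
have [/ramp_ge1 ->|t1] := leP 1 t; first by rewrite lexx ler01.
rewrite /ramp /sqrp (gtr0_norm t0) (@ltr0_norm _ (t - 1)); last lra.
by have [h|h] := ger0P (t - 2^-1); apply/andP; split; nra.
Qed.

Lemma ramp'_ge0 (t : R) : 0 <= ramp' t.
Proof.
rewrite /ramp'.
by have [h|h] := ger0P (t - 2^-1); have [h1|h1] := ger0P t;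
  have [h2|h2] := ger0P (t - 1); lra.
Qed.

Lemma ramp'_eq0 (t : R) : (t <= 0) || (1 <= t) -> ramp' t = 0.
Proof.
rewrite /ramp' => /orP[t0|t1]; first by rewrite !ler0_norm; lra.
by rewrite !ger0_norm; lra.
Qed.

Lemma ramp_quadratic (t s : R) : `|ramp (t + s) - ramp t - s * ramp' t| <= 8 * s ^+ 2.
Proof.
have := sqrp_quadratic t s; have := sqrp_quadratic (t - 2^-1) s.
have := sqrp_quadratic (t - 1) s.
rewrite /ramp /ramp' !ler_norml (addrAC t _ s) (addrAC t _ s).
by move=> /andP[? ?] /andP[? ?] /andP[? ?]; apply/andP; split; lra.
Qed.

Lemma continuous_ramp' : continuous ramp'.
Proof.
move=> t; apply: cvgM; first exact: cvg_cst.
have c (s : R) : (x - s + `|x - s|) @[x --> t] --> t - s + `|t - s|.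
  have cs : (x - s) @[x --> t] --> t - s by apply: cvgB; [exact: cvg_id|exact: cvg_cst].
  by apply: cvgD => //; exact: cvg_norm.
apply: cvgD => //; apply: cvgB; last by apply: cvgM => //; exact: cvg_cst.
by apply: cvgD; [exact: cvg_id|apply: cvg_norm; exact: cvg_id].
Qed.

Definition step (k a x : R) : R := ramp (k * (x - a)).
Definition step' (k a x : R) : R := k * ramp' (k * (x - a)).

Lemma is_derive_step k a x : is_derive x 1 (step k a) (step' k a x).
Proof.
apply: (@is_derive_quadratic _ _ _ (8 * k ^+ 2)) => s; rewrite /step /step'.
have := ramp_quadratic (k * (x - a)) (k * s).
have -> : k * (x + s - a) = k * (x - a) + k * s by ring.
by rewrite exprMn !mulrA (mulrC k s).
Qed.

Lemma continuous_step' k a : continuous (step' k a).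
Proof.
move=> x; apply: cvgM; first exact: cvg_cst.
apply: (@continuous_comp _ _ _ (fun x => k * (x - a)) ramp'); last exact: continuous_ramp'.
apply: cvgM; first exact: cvg_cst.
by apply: cvgB; [exact: cvg_id|exact: cvg_cst].
Qed.

Lemma continuous_step k a : continuous (step k a).
Proof.
by move=> x; exact: is_derive_continuous (is_derive_step k a x).
Qed.

Lemma step_itv k a x : 0 <= step k a x <= 1.
Proof. exact: ramp_itv. Qed.

Lemma step_lt k a x : 0 < k -> x <= a -> step k a x = 0.
Proof. by move=> k0 xa; rewrite /step ramp_le0// pmulr_rle0// subr_le0. Qed.

Lemma step_gt k a x : 0 < k -> a + k^-1 <= x -> step k a x = 1.
Proof.
move=> k0 xa; rewrite /step ramp_ge1// -(mulfV (lt0r_neq0 k0)) ler_pM2l//; lra.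
Qed.

Lemma step'_ge0 k a x : 0 <= k -> 0 <= step' k a x.
Proof. by move=> k0; rewrite mulr_ge0// ramp'_ge0. Qed.

Lemma step'_eq0 k a x : 0 < k -> (x <= a) || (a + k^-1 <= x) -> step' k a x = 0.
Proof.
move=> k0 xa; rewrite /step' ramp'_eq0 ?mulr0//.
case/orP : xa => xa; apply/orP; [left|right].
  by rewrite pmulr_rle0// subr_le0.
rewrite -(mulfV (lt0r_neq0 k0)) ler_pM2l//; lra.
Qed.

(** A smoothed indicator of [a, b].  Its support lies in [a, b + 1/k], whence
the condition on k. *)
Lemma test_trapezoid k a b : 0 < k -> 0 < a -> a <= b -> b + k^-1 < 1 ->
  test_function (fun x => step k a x - step k b x) /\
  derive1 (fun x => step k a x - step k b x) = fun x => step' k a x - step' k b x.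
Proof.
move=> k0 a0 ab bk.
have D x : is_derive x 1 (fun x => step k a x - step k b x) (step' k a x - step' k b x).
  have h1 := is_derive_step k a x; have h2 := is_derive_step k b x.
  exact: is_deriveB.
have E : derive1 (fun x => step k a x - step k b x) = fun x => step' k a x - step' k b x.
  by apply/funext => x; rewrite derive1E; have [_ ->] := D x.
split => //; split.
- by move=> x; have [] := D x.
- by rewrite E => x; apply: cvgB; exact: continuous_step'.
have kV : 0 < k^-1 by rewrite invr_gt0.
exists a, (b + k^-1); split => //.
move=> x; apply: contraNT; rewrite negb_and -!ltNge => /orP[xa|bx].
  rewrite !step_lt ?subrr// ltW// (lt_le_trans xa)//.
by rewrite !step_gt ?subrr//; lra.
Qed.

Lemma L2_continuous f : {within `[0%R, 1%R], continuous f} -> L2 f.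
Proof.
move=> cf; apply/L2P; split.
  apply: measurable_funS (subspace_continuous_measurable_fun _ cf) => //.
  exact: subset_itv_oo_cc.
apply: (@integrableS _ _ _ mu `[0%R, 1%R]) => //; first exact: subset_itv_oo_cc.
apply: continuous_compact_integrable; first exact: segment_compact.
by move=> x; apply: cvgM; exact: cf.
Qed.

Lemma Rintegral_oo_cc f a b : mu.-integrable `[a, b] (EFin \o f) ->
  \int[mu]_(x in `]a, b[) f x = \int[mu]_(x in `[a, b]) f x.
Proof.
move=> fi; rewrite Rintegral_itv_bndo_bndc ?Rintegral_itv_obnd_cbnd//.
  apply: integrableS fi => //; apply: subset_itvr; by rewrite bnd_simp.
apply: integrableS fi => //; exact: subset_itv_oo_cc.
Qed.

Lemma continuous_integrable01 f : {within `[0%R, 1%R], continuous f} ->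
  mu.-integrable `[0%R, 1%R] (EFin \o f).
Proof. by move=> cf; apply: continuous_compact_integrable => //; exact: segment_compact. Qed.

Lemma Rintegral_derivative f g : (forall x, is_derive x 1 f (g x)) -> continuous g ->
  \int[mu]_(x in I) g x = f 1 - f 0.
Proof.
move=> fg cg.
have Lg : L2 g by apply: L2_continuous; exact: continuous_subspaceT.
rewrite Rintegral_oo_cc; last exact/continuous_integrable01/continuous_subspaceT.
have cf : continuous f.
  by move=> x; exact: is_derive_continuous (fg x).
rewrite /Rintegral (@continuous_FTC2 _ g f 0 1) ?ltr01//.
- exact: continuous_subspaceT.
- split; first by move=> x _; have [] := fg x.
  + by apply: cvg_at_right_filter; exact: cf.
  + by apply: cvg_at_left_filter; exact: cf.
- by move=> x _; rewrite derive1E; have [_ ->] := fg x.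
Qed.

Lemma Rintegral_step' k a : 0 < k -> 0 <= a -> a + k^-1 <= 1 ->
  \int[mu]_(x in I) step' k a x = 1.
Proof.
move=> k0 a0 ak.
have -> := Rintegral_derivative (is_derive_step k a) (@continuous_step' k a).
by rewrite step_gt// step_lt// subr0.
Qed.

Lemma near_invS_lt (d : R) : 0 < d -> \forall n \near \oo, (n.+1%:R : R)^-1 < d.
Proof. by move=> d0; exact: near_infty_natSinv_lt (PosNum d0). Qed.

(** The derivatives of the steps concentrate at a. *)
Lemma cvg_Rintegral_step' u a : L2 u -> {for a, continuous u} -> 0 < a < 1 ->
  \int[mu]_(x in I) (u x * step' n.+1%:R a x) @[n --> \oo] --> u a.
Proof.
move=> Lu cu /andP[a0 a1]; apply/cvgrPdist_le => e e0.
have [d /= d0 ud] : exists2 d, 0 < d & forall x, `|x - a| < d -> `|u x - u a| <= e.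
  move/cvgrPdist_le : cu => /(_ e e0) /nbhs_ballP[d /= d0 ud].
  exists d => // x xa; rewrite distrC; apply: ud.
  by rewrite /ball/= distrC.
near=> n.
have kd : (n.+1%:R : R)^-1 < d by near: n; exact: near_invS_lt.
have ka : (n.+1%:R : R)^-1 < 1 - a.
  by near: n; apply: near_invS_lt; rewrite subr_gt0.
have k0 : (0 : R) < n.+1%:R by rewrite ltr0n.
move: kd ka k0; move: (n.+1%:R : R) => k kd ka k0.
have Lk : L2 (step' k a).
  by apply: L2_continuous; apply: continuous_subspaceT; exact: continuous_step'.
have int1 : \int[mu]_(x in I) step' k a x = 1.
  by apply: Rintegral_step' => //; [exact: ltW|rewrite -lerBrDl ltW].
have i1 := L2_mul_integrable Lu Lk.
have i2 : mu.-integrable I (EFin \o (fun x => u a * step' k a x)).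
  by apply: integrable_scale => //; exact: L2_integrable.
have -> : u a = \int[mu]_(x in I) (u a * step' k a x).
  by rewrite RintegralZl// ?int1 ?mulr1//; exact: L2_integrable.
rewrite -RintegralB//.
have i3 : mu.-integrable I (EFin \o (fun x => u a * step' k a x - u x * step' k a x)).
  have := integrable_add mI i2 (integrable_scale (-1) mI i1).
  by apply: eq_integrable => // x _ /=; rewrite mulN1r.
apply: (le_trans (le_normr_Rintegral mI i3)).
have -> : e = \int[mu]_(x in I) (e * step' k a x).
  by rewrite RintegralZl// ?int1 ?mulr1//; exact: L2_integrable.
apply: le_Rintegral => //.
- exact: (integrable_norm i3).
- by apply: integrable_scale => //; exact: L2_integrable.
- move=> x _; rewrite -mulrBl normrM (ger0_norm (step'_ge0 a x (ltW k0))).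
  have [xa|xa] := leP x a; first by rewrite step'_eq0 ?xa// !mulr0.
  have [xk|xk] := leP (a + k^-1) x; first by rewrite step'_eq0 ?xk ?orbT// !mulr0.
  apply: ler_wpM2r; first exact: step'_ge0 (ltW k0).
  by rewrite distrC; apply: ud; rewrite ger0_norm; lra.
Unshelve. all: by end_near. Qed.

Lemma cvg_Rintegral_step g a : L2 g -> 0 < a < 1 ->
  \int[mu]_(x in I) (g x * step n.+1%:R a x) @[n --> \oo] --> prim g 1 - prim g a.
Proof.
move=> Lg /andP[a0 a1].
have -> : prim g 1 - prim g a = \int[mu]_(x in I) (g \_ `]a, 1[) x.
  rewrite primB// ?ltW// -Rintegral_mkcondr; congr Rintegral.
  by rewrite setIidr//; apply: itv_subI => //; exact: ltW.
have mstep k : measurable_fun I (step k a).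
  apply: L2_measurable; apply: L2_continuous; apply: continuous_subspaceT.
  exact: continuous_step.
apply: (@Rintegral_dominated _ _ (fun x => `|g x|)).
- by move=> n; apply: measurable_funM => //; exact: L2_measurable.
- have Li : mu.-integrable (I `&` `]a, 1[) (EFin \o g).
    by apply: integrableS (L2_integrable Lg) => //; exact: measurableI.
  have := (integrable_restrict mu (measurable_itv `]a, 1[) mI (EFin \o g)).1 Li.
  by rewrite restrict_EFin => /measurable_int /measurable_EFinP.
- apply: aeW => x Ix; rewrite patchE; case: ifPn.
    rewrite inE /= in_itv/= => /andP[ax _].
    apply: cvg_near_cst; near=> n.
    rewrite step_gt ?mulr1// -lerBrDl ltW//; near: n.
    by apply: near_invS_lt; rewrite subr_gt0.
  rewrite notin_setE /= in_itv/= => /negP.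
  move: (Ix); rewrite /= in_itv/= => /andP[_ ->]; rewrite andbT -leNgt => xa.
  apply: cvg_near_cst; near=> n.
  by rewrite step_lt// mulr0.
- exact: (integrable_norm (L2_integrable Lg)).
- move=> n x _; rewrite normrM ler_piMr//.
  by have /andP[s0 s1] := step_itv n.+1%:R a x; rewrite ger0_norm.
Unshelve. all: by end_near. Qed.

Lemma continuous_prim g : L2 g -> {within `[0%R, 1%R], continuous (prim g)}.
Proof.
move=> Lg; apply/subspace_continuousP => x /= x01; apply/cvgrPdist_le => e e0.
have S1 : 0 < sqL2 g + 1 by rewrite ltr_wpDl// sqL2_ge0.
have d0 : 0 < e ^+ 2 / (sqL2 g + 1) by rewrite divr_gt0// exprn_gt0.
rewrite near_withinE; near=> y => y01.
rewrite -(@ler_pXn2r _ 2) ?nnegrE ?(ltW e0)// real_normK ?num_real//.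
have yx : `|x - y| < e ^+ 2 / (sqL2 g + 1).
  by near: y; exact: cvgr_dist_lt.
have {}x01 : 0 <= x <= 1 by move: x01; rewrite ?inE/= ?in_itv.
have {}y01 : 0 <= y <= 1 by move: y01; rewrite ?inE/= ?in_itv.
apply: (le_trans (sqr_primB_le Lg y01 x01)).
move: yx; rewrite ltr_pdivlMr// => /ltW; apply: le_trans.
by apply: ler_wpM2l => //; rewrite lerDl.
Unshelve. all: by end_near. Qed.

(** The definition of the weak derivative is tested with smoothed indicators of
[a, b], which become sharp in the limit. *)
Lemma wderiv_increment_oo u g a b : {within `[0%R, 1%R], continuous u} -> is_wderiv u g ->
  0 < a -> a <= b -> b < 1 -> u b - u a = prim g b - prim g a.
Proof.
move=> cu [Lu Lg ug] a0 ab b1.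
have cuo x : 0 < x < 1 -> {for x, continuous u}.
  move=> x01; have /(continuous_within_itvP _ ltr01)[+ _ _] := cu.
  by apply; rewrite in_itv.
have [b0 a1] : 0 < b /\ a < 1 by split; [exact: lt_le_trans ab|exact: le_lt_trans b1].
have a01 : 0 < a < 1 by rewrite a0.
have b01 : 0 < b < 1 by rewrite b0.
have cl := cvgB (cvg_Rintegral_step' Lu (cuo _ a01) a01)
                (cvg_Rintegral_step' Lu (cuo _ b01) b01).
have cr := cvgB (cvg_Rintegral_step Lg a01) (cvg_Rintegral_step Lg b01).
have {}cl := cl eventually_filter; have {}cr := cr eventually_filter.
have Ls k c : L2 (step k c).
  by apply/L2_continuous/continuous_subspaceT; exact: continuous_step.
have Ls' k c : L2 (step' k c).
  by apply/L2_continuous/continuous_subspaceT; exact: continuous_step'.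
have cl' : (fun n => \int[mu]_(x in I) (u x * step' n.+1%:R a x) -
             \int[mu]_(x in I) (u x * step' n.+1%:R b x)) @ \oo -->
   - (prim g 1 - prim g a - (prim g 1 - prim g b)).
  apply: cvg_trans (cvgN cr); apply: near_eq_cvg; near=> n => /=.
  have k0 : (0 : R) < n.+1%:R by rewrite ltr0n.
  have kb : b + (n.+1%:R)^-1 < 1.
    by rewrite -ltrBrDl; near: n; apply: near_invS_lt; rewrite subr_gt0.
  have [tf tE] := test_trapezoid k0 a0 ab kb.
  have := ug _ tf; rewrite tE => {}ug.
  rewrite !fctE.
  rewrite -RintegralB//; try exact: L2_mul_integrable.
  rewrite -RintegralB//; try exact: L2_mul_integrable.
  transitivity (- \int[mu]_(x in I) (g x * (step n.+1%:R a x - step n.+1%:R b x))).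
    by congr (- _); apply: eq_Rintegral => x _; rewrite mulrBr.
  by rewrite -ug; apply: eq_Rintegral => x _; rewrite mulrBr.
have := cvg_unique _ cl cl'.
move=> /(_ (@Rhausdorff R)) => h.
by rewrite -(opprB (u a)) h; ring.
Unshelve. all: by end_near. Qed.

(** Both sides are continuous on [0, 1], so the endpoints follow from the open
interval. *)
Lemma wderiv_increment u g a b : {within `[0%R, 1%R], continuous u} -> is_wderiv u g ->
  0 <= a <= 1 -> 0 <= b <= 1 -> u b - u a = prim g b - prim g a.
Proof.
move=> cu ug; have [_ Lg _] := ug.
pose h x := u x - prim g x.
have ch : {within `[0%R, 1%R], continuous h}.
  by move=> x; apply: cvgB; [exact: cu|exact: continuous_prim].
have /(continuous_within_itvP _ ltr01)[_ h0 h1] := ch.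
have hoo x : 0 < x < 1 -> h x = h 2^-1.
  move=> /andP[x0 x1]; rewrite /h.
  have V1 : (2^-1 : R) < 1 by lra.
  have V0 : (0 : R) < 2^-1 by lra.
  have [xh|/ltW xh] := leP x 2^-1.
    have := wderiv_increment_oo cu ug x0 xh V1; lra.
  have := wderiv_increment_oo cu ug V0 xh x1; lra.
have hE x : 0 <= x <= 1 -> h x = h 2^-1.
  move=> /andP[]; rewrite le_eqVlt => /predU1P[<- _|x0].
    apply: (cvg_unique (@Rhausdorff R) h0); apply: cvg_near_cst.
    near=> y; apply: hoo; apply/andP; split; near: y.
      exact: nbhs_right_gt.
    exact: nbhs_right_lt.
  rewrite le_eqVlt => /predU1P[->|x1]; last by apply: hoo; rewrite x0.
  apply: (cvg_unique (@Rhausdorff R) h1); apply: cvg_near_cst.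
  near=> y; apply: hoo; apply/andP; split; near: y.
    exact: nbhs_left_gt.
  exact: nbhs_left_lt.
move=> a01 b01; have := hE _ a01; rewrite -(hE _ b01) /h; lra.
Unshelve. all: by end_near. Qed.
End Sobolev.

(** * Weak derivatives: examples and uniqueness *)
Section Sobolev2.
Context {R : realType}.
Implicit Types (f g u phi : R -> R) (a b x : R).
Local Notation mu := (@lebesgue_measure R).
Local Notation I := (`]0%R, 1%R[%classic : set R).

Lemma wderiv_lin a u g v h : is_wderiv u g -> is_wderiv v h ->
  is_wderiv (fun x => a * u x + v x) (fun x => a * g x + h x).
Proof.
move=> [Lu Lg ug] [Lv Lh vh]; split; try by apply: L2D => //; exact: L2Z.
move=> phi tphi; have [dphi cphi [p [q [p0 q1 pq]]]] := tphi.
have Lp : L2 phi.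
  apply/L2_continuous/continuous_subspaceT => x.
  by apply: differentiable_continuous; apply/derivable1_diffP.
have Lp' : L2 (derive1 phi) by exact/L2_continuous/continuous_subspaceT.
have E f1 f2 psi : L2 f1 -> L2 f2 -> L2 psi ->
    \int[mu]_(x in I) ((a * f1 x + f2 x) * psi x) =
    a * \int[mu]_(x in I) (f1 x * psi x) + \int[mu]_(x in I) (f2 x * psi x).
  move=> L1 L2f Lpsi; rewrite -RintegralZl//; last exact: L2_mul_integrable.
  rewrite -RintegralD//; [|exact/integrable_scale/L2_mul_integrable/Lpsi|exact: L2_mul_integrable].
  by apply: eq_Rintegral => x _; rewrite mulrDl mulrA.
by rewrite !E// ug// vh// mulrN opprD.
Qed.

(** Two-sided derivatives are required at 0 and 1 as well, so that sums and
products need no care at the endpoints. *)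
Definition C1 u g := forall x, 0 <= x <= 1 -> is_derive x 1 u (g x) /\ {for x, continuous g}.

Lemma C1_within_continuous u g : C1 u g ->
  {within `[0%R, 1%R], continuous u} /\ {within `[0%R, 1%R], continuous g}.
Proof.
move=> ug; split; apply: continuous_in_subspaceT => x; rewrite inE/= in_itv => x01.
  by have [du _] := ug x x01; exact: is_derive_continuous du.
by have [] := ug x x01.
Qed.

Lemma derive_wderiv u g : {within `[0%R, 1%R], continuous u} ->
  {within `[0%R, 1%R], continuous g} ->
  (forall x, 0 < x < 1 -> is_derive x 1 u (g x)) -> is_wderiv u g.
Proof.
move=> cu cg ug; split; [exact: L2_continuous|exact: L2_continuous|].
move=> phi [dphi cphi [a [b [a0 b1 phi0]]]].
have cp : continuous phi.
  by move=> x; apply: differentiable_continuous; apply/derivable1_diffP.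
have p0 : phi 0 = 0 by apply/eqP; apply: contraPT isT => /phi0; lra.
have p1 : phi 1 = 0 by apply/eqP; apply: contraPT isT => /phi0; lra.
rewrite Rintegral_oo_cc; last first.
  apply: continuous_integrable01 => x; apply: cvgM; first exact: cu.
  exact: continuous_subspaceT.
rewrite Rintegral_oo_cc; last first.
  apply: continuous_integrable01 => x; apply: cvgM; first exact: cg.
  exact: continuous_subspaceT.
rewrite (@Rintegration_by_parts _ u phi g (derive1 phi) 0 1 ltr01 cg).
- by rewrite p0 p1 !mulr0 subrr sub0r.
- have /(continuous_within_itvP _ ltr01)[_ cu0 cu1] := cu.
  by split => // x; rewrite in_itv/= => /ug[].
- by move=> x; rewrite in_itv/= => /ug[_ <-]; rewrite derive1E.
- exact: continuous_subspaceT.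
- split; first by move=> x _; exact: dphi.
  + by apply: cvg_at_right_filter; exact: cp.
  + by apply: cvg_at_left_filter; exact: cp.
- by [].
Qed.

Lemma C1_wderiv u g : C1 u g -> is_wderiv u g.
Proof.
move=> ug; have [cu cg] := C1_within_continuous ug.
by apply: derive_wderiv => // x /andP[x0 x1]; have [] := ug x ltac:(by rewrite !ltW).
Qed.

Lemma prim_wderiv g : {within `[0%R, 1%R], continuous g} -> is_wderiv (prim g) g.
Proof.
move=> cg; have Lg := L2_continuous cg.
apply: derive_wderiv => //; first exact: continuous_prim.
move=> x /andP[x0 x1].
have cx : {for x, continuous g}.
  have /(continuous_within_itvP _ ltr01)[+ _ _] := cg.
  by apply; rewrite in_itv/= x0.
have gi (y : R) : y < 1 -> mu.-integrable `]0, y] (EFin \o g).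
  move=> y1; apply: L2_integrable_sub => // t /=; rewrite !in_itv/=.
  by move=> /andP[-> /le_lt_trans ->].
have xm : x < (x + 1) / 2 by lra.
have x0' : (BRight 0 < BRight x)%O by rewrite bnd_simp.
have [|dF F'] := continuous_FTC1 xm (gi _ _) x0' cx; first by lra.
have E : \near x, \int[mu]_(t in `]0, x]) g t = prim g x.
  have : nbhs x I by apply: open_nbhs_nbhs; split; [exact: interval_open|rewrite /= in_itv/= x0].
  apply: filterS => y; rewrite /= in_itv/= => /andP[y0 y1].
  rewrite /prim Rintegral_itv_bndo_bndc//.
  by apply: L2_integrable_sub => //; apply: itv_subI => //; exact: ltW.
apply: (near_eq_is_derive E).
by apply: DeriveDef; [exact: dF|rewrite -F' derive1E].
Qed.

Lemma Rintegral_itvNy g x : L2 g -> 0 <= x < 1 ->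
  \int[mu]_(t in `]-oo, x]) (g \_ I) t = prim g x.
Proof.
move=> Lg /andP[x0 x1]; rewrite -Rintegral_mkcondr /prim.
rewrite Rintegral_itv_bndo_bndc; last first.
  by apply: L2_integrable_sub => //; apply: itv_subI => //; exact: ltW.
congr Rintegral; apply/seteqP; split => t /=; rewrite !in_itv/=.
  by move=> [-> /andP[-> _]].
by move=> /andP[t0 tx]; rewrite tx t0 (le_lt_trans tx x1).
Qed.

Lemma L2_integrableT g : L2 g -> mu.-integrable setT (EFin \o (g \_ I)).
Proof.
move=> Lg; rewrite -restrict_EFin; apply/integrable_restrict => //.
by rewrite setTI; exact: L2_integrable.
Qed.

Lemma FTC1_L2 g : L2 g -> let F x := \int[mu]_(t in `]-oo, x]) (g \_ I) t in
  {ae mu, forall x, derivable F x 1 /\ derive1 F x = (g \_ I) x}.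
Proof.
move=> Lg F; apply: FTC1Ny.
  by move=> y; apply: integrableS (L2_integrableT Lg).
by apply: open_integrable_locally => //; [exact: openT|exact: L2_integrableT].
Qed.

(** By Lebesgue's differentiation theorem a function is almost everywhere the
derivative of its primitive. *)
Lemma prim_eq0 g : L2 g -> (forall x, 0 <= x <= 1 -> prim g x = 0) -> sqL2 g = 0.
Proof.
move=> Lg g0; rewrite /sqL2 /Rintegral.
rewrite (@ae_eq_integral _ _ _ mu I (cst 0) (EFin \o (fun x => g x ^+ 2)))//.
- by rewrite integral0.
- by apply/measurable_EFinP; apply: measurable_funX; exact: L2_measurable.
have := FTC1_L2 Lg; apply: filterS; first exact: (ae_filter_ringOfSetsType mu).
move=> x /= + Ix; rewrite patchE mem_set// => -[_ <-].
set F := (X in derive1 X _).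
rewrite (_ : derive1 F x = 0) ?expr0n//.
rewrite derive1E (@near_eq_derive _ _ _ F (cst 0)) ?derive_cst//.
have : nbhs x I by apply: open_nbhs_nbhs; split => //; exact: interval_open.
apply: filterS => y; rewrite /= in_itv/= => /andP[y0 y1].
by rewrite /F Rintegral_itvNy ?(ltW y0)// g0// !ltW.
Qed.

(** Makes the choice involved in [wderiv] harmless in norm estimates. *)
Lemma wderiv_unique u g h : {within `[0%R, 1%R], continuous u} ->
  is_wderiv u g -> is_wderiv u h -> sqL2 (fun x => g x - h x) = 0.
Proof.
move=> cu ug uh; have [_ Lg _] := ug; have [_ Lh _] := uh.
apply: prim_eq0; first exact: L2B.
move=> x x01.
have -> : prim (fun x => g x - h x) x = prim g x - prim h x.
  rewrite -mulN1r -primZ//; last by case/andP : x01.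
  rewrite -primD//; [|exact: L2Z|by case/andP : x01].
  by apply: eq_Rintegral => t _; rewrite mulN1r.
have z01 : 0 <= (0 : R) <= 1 by rewrite lexx ler01.
have := wderiv_increment cu ug z01 x01; have := wderiv_increment cu uh z01 x01.
rewrite !prim0; lra.
Qed.
End Sobolev2.

(** * Density of smooth functions vanishing at the endpoints *)
Section Density.
Context {R : realType}.
Implicit Types (f g u phi : R -> R) (a b x : R).
Local Notation mu := (@lebesgue_measure R).
Local Notation I := (`]0%R, 1%R[%classic : set R).

(** The vanishing boundary values make the approximants compatible with
whatever conditions hold at the nodes. *)
Definition approx0 f := forall e, 0 < e -> exists u g,
  [/\ C1 u g, u 0 = 0, u 1 = 0 & sqL2 (fun x => f x - u x) < e].

Lemma C1_L2 u g : C1 u g -> L2 u.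
Proof. by move=> /C1_within_continuous[cu _]; exact: L2_continuous. Qed.

Lemma approx0_closed f : L2 f ->
  (forall e, 0 < e -> exists h, [/\ L2 h, approx0 h & sqL2 (fun x => f x - h x) < e]) ->
  approx0 f.
Proof.
move=> Lf fh e e0; have e4 : 0 < e / 4 by lra.
have [h [Lh /(_ _ e4)[u [g [ug u0 u1 hu]]] fhe]] := fh _ e4.
exists u, g; split => //.
rewrite (@eq_sqL2 _ _ (fun x => (f x - h x) + (h x - u x))); last by move=> x _; ring.
apply: (le_lt_trans (sqL2D (L2B Lf Lh) (L2B Lh (C1_L2 ug)))); lra.
Qed.

Lemma sqL2_dominated (f_ : nat -> R -> R) f G : (forall n, L2 (f_ n)) -> L2 f -> L2 G ->
  {ae mu, forall x, I x -> f_ n x @[n --> \oo] --> f x} ->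
  (forall n x, I x -> `|f x - f_ n x| <= G x) ->
  sqL2 (fun x => f x - f_ n x) @[n --> \oo] --> 0.
Proof.
move=> Lf_ Lf LG cf fG.
rewrite [X in _ --> X](_ : _ = \int[mu]_(x in I) (cst 0 x)); last first.
  by rewrite /Rintegral integral0.
apply: (@Rintegral_dominated _ _ _ (fun x => G x ^+ 2)).
- by move=> n; apply: measurable_funX; apply: L2_measurable; exact: L2B.
- exact: measurable_cst.
- move: cf; apply: filterS; first exact: (ae_filter_ringOfSetsType mu).
  move=> x + Ix => /(_ Ix) cx.
  have -> : cst 0 x = (f x - f x) * (f x - f x) :> R by rewrite subrr mulr0.
  under eq_fun do rewrite expr2.
  by apply: cvgM; apply: cvgB => //; exact: cvg_cst.
- exact: L2_sqr_integrable.
- move=> n x Ix; rewrite normrX lerXn2r ?nnegrE ?fG//.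
  exact: le_trans (fG n x Ix).
Qed.

Lemma approx0_dominated (f_ : nat -> R -> R) f G : (forall n, L2 (f_ n)) -> L2 f -> L2 G ->
  {ae mu, forall x, I x -> f_ n x @[n --> \oo] --> f x} ->
  (forall n x, I x -> `|f x - f_ n x| <= G x) ->
  (forall n, approx0 (f_ n)) -> approx0 f.
Proof.
move=> Lf_ Lf LG cf fG af; apply: approx0_closed => // e e0.
have /cvgrPdist_lt/(_ e e0)[N _ /(_ N)] := sqL2_dominated Lf_ Lf LG cf fG.
move=> /(_ (leqnn N)); rewrite sub0r normrN ger0_norm ?sqL2_ge0// => h.
by exists (f_ N).
Qed.

(** Multiplication by the cut-off 1 - (1 - 2x)^(2m), which vanishes at 0 and 1
and tends to 1 in between as m grows. *)
Lemma C1_approx0 u g : C1 u g -> approx0 u.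
Proof.
move=> ug.
pose q (n : nat) x : R := 1 - (1 - 2 * x) ^+ n.*2.+2.
pose q' (n : nat) x : R := (2 * n.*2.+2%:R) * (1 - 2 * x) ^+ n.*2.+1.
have dq n x : is_derive x 1 (q n) (q' n x).
  have d1 : is_derive x 1 (fun x => 1 - 2 * x : R) (- 2 : R).
    apply: (@is_derive_quadratic _ _ _ _ 0) => h.
    by rewrite mul0r (_ : _ - _ = 0) ?normr0//; ring.
  have d2 := @is_deriveX _ _ _ n.*2.+2 _ _ _ d1.
  have d3 := is_deriveB (is_derive_cst (1 : R) x 1) d2.
  have -> : q n = cst 1 - (fun x => 1 - 2 * x) ^+ n.*2.+2.
    by apply/funext => y; rewrite /q !fctE.
  apply: (is_derive_eq d3).
  rewrite sub0r -pred_Sn /q'.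
  by move: (_ ^+ n.*2.+1) (n.*2.+2%:R : R) => p r; rewrite /GRing.scale/=; ring.
have cq' n : continuous (q' n).
  move=> x; apply: cvgM; first exact: cvg_cst.
  apply: (@continuous_comp _ _ _ (fun x => 1 - 2 * x : R) (fun y : R => y ^+ _)).
    by apply: cvgB; [exact: cvg_cst|apply: cvgM; [exact: cvg_cst|exact: cvg_id]].
  exact: exprn_continuous.
have abs12 x : I x -> `|1 - 2 * x| < 1.
  by rewrite /= in_itv/= => /andP[x0 x1]; rewrite ltr_norml; apply/andP; split; lra.
have qC n : C1 (q n) (q' n) by move=> x _; split; [exact: dq|exact: cq'].
have uqC n : C1 (fun x => u x * q n x) (fun x => u x * q' n x + q n x * g x).
  move=> x x01; have [du cg] := ug x x01; split.
    by apply: (is_derive_eq (is_deriveM du (dq n x))); rewrite /GRing.scale/=.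
  have cu : {for x, continuous u}.
    exact: is_derive_continuous du.
  have cqn : {for x, continuous (q n)}.
    exact: is_derive_continuous (dq n x).
  apply: cvgD; apply: cvgM => //; exact: cq'.
have Lu := C1_L2 ug.
apply: (@approx0_dominated (fun n x => u x * q n x) _ (fun x => `|u x|)) => //.
- by move=> n; exact: C1_L2 (uqC n).
- apply/L2P; split; first by apply: measurableT_comp => //; exact: L2_measurable.
  by apply: eq_integrable (L2_sqr_integrable Lu) => // x _ /=; rewrite real_normK ?num_real.
- apply: aeW => x Ix; rewrite -[X in _ --> X]mulr1.
  apply: cvgM; first exact: cvg_cst.
  rewrite -[X in _ --> X]subr0; apply: cvgB; first exact: cvg_cst.
  have h2 : `|(1 - 2 * x) ^+ 2| < 1.
    by rewrite normrX expr_lt1//; exact: abs12.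
  have := cvg_expr h2; rewrite -cvg_shiftS/=.
  by under eq_fun do rewrite -exprM mul2n doubleS.
- move=> n x Ix; rewrite /q (_ : _ - _ = u x * (1 - 2 * x) ^+ n.*2.+2); last by ring.
  rewrite normrM ler_piMr// normrX exprn_ile1// ltW//; exact: abs12.
- move=> n e e0; exists (fun x => u x * q n x), (fun x => u x * q' n x + q n x * g x).
  split; [exact: uqC| | |].
  + by rewrite /q mulr0 subr0 expr1n subrr mulr0.
  + rewrite /q mulr1 (_ : 1 - 2 = -1 :> R); last by ring.
    by rewrite -signr_odd /= negbK odd_double expr0 subrr mulr0.
  + rewrite /sqL2 (_ : \int[mu]_(x in I) _ = 0)//.
    transitivity (\int[mu]_(x in I) (cst 0 x)); last by rewrite /Rintegral integral0.
    by apply: eq_Rintegral => x _; rewrite subrr expr0n.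
Qed.

End Density.

Section Steklov.
Context {R : realType}.
Implicit Types (f g u phi : R -> R) (a b x h M m : R).
Local Notation mu := (@lebesgue_measure R).
Local Notation I := (`]0%R, 1%R[%classic : set R).

(** A class preserved by Steklov averages and on which integrals from minus
infinity make sense.  Working on the whole line avoids boundary effects. *)
Definition tame f := [/\ measurable_fun setT f, exists M, forall x, `|f x| <= M &
  exists m, forall x, x < m -> f x = 0].

Lemma tame_integrable f b : tame f -> mu.-integrable `]-oo, b] (EFin \o f).
Proof.
move=> [mf [M fM] [m f0]].
have mJ : measurable (`[m, b]%classic : set (measurableTypeR R)) by exact: measurable_itv.
have h : mu.-integrable `[m, b] (EFin \o f).
  apply: measurable_bounded_integrable => //.
  - by rewrite /= lebesgue_measure_itv; case: ifP => _; rewrite ?ltry// -EFinB ltry.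
  - exact: measurable_funS mf.
  - exists M; split; first exact: num_real.
    by move=> y My x _ /=; rewrite (le_trans (fM x))// ltW.
have mK : measurable (`]-oo, b]%classic : set (measurableTypeR R)) by exact: measurable_itv.
have := (integrable_restrict mu mJ mK (EFin \o f)).1.
rewrite setIidr; last by move=> x /=; rewrite !in_itv/= => /andP[].
move=> /(_ h); apply: eq_integrable => // x; rewrite inE/= in_itv/= => xb.
rewrite patchE; case: ifPn => //; rewrite notin_setE/= in_itv/= xb andbT => /negP.
by rewrite -ltNge => /f0 ->.
Qed.

Definition iprim f x : R := \int[mu]_(t in `]-oo, x]) f t.

Lemma iprimB f a b : tame f -> a <= b ->
  iprim f b - iprim f a = \int[mu]_(t in `]a, b]) f t.
Proof.
by move=> tf ab; rewrite Rintegral_itvB ?bnd_simp//; exact: tame_integrable.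
Qed.

Lemma iprim_lip f M a b : tame f -> (forall x, `|f x| <= M) -> a <= b ->
  `|iprim f b - iprim f a| <= M * (b - a).
Proof.
move=> tf fM ab; rewrite iprimB//.
have mJ : measurable (`]a, b]%classic : set (measurableTypeR R)) by exact: measurable_itv.
have fi : mu.-integrable `]a, b] (EFin \o f).
  by apply: integrableS (tame_integrable b tf) => // x /=; rewrite !in_itv/= => /andP[].
apply: (le_trans (le_normr_Rintegral mJ fi)).
have muJ : mu `]a, b] = (b - a)%:E.
  rewrite lebesgue_measure_itv/= lte_fin; case: ltP => // ba.
  by rewrite (@le_anti _ _ a b) ?subrr// ab.
apply: (@le_trans _ _ (\int[mu]_(t in `]a, b]) M)).
  apply: le_Rintegral => //; first exact: (integrable_norm fi).
  apply: measurable_bounded_integrable => //; first by rewrite /= muJ ltry.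
  exists `|M|; split; first exact: num_real.
  by move=> y My x _ /=; exact: ltW.
by rewrite Rintegral_cst// -[X in fine X]/(mu `]a, b]) muJ.
Qed.

Definition steklov f h x : R := (iprim f (x + h) - iprim f x) / h.

Lemma steklov_bound f M h x : tame f -> (forall x, `|f x| <= M) -> 0 < h ->
  `|steklov f h x| <= M.
Proof.
move=> tf fM h0; rewrite /steklov normrM normfV (gtr0_norm h0) ler_pdivrMr//.
by have := @iprim_lip _ _ x (x + h) tf fM; rewrite (addrC x) addrK; apply; rewrite lerDr ltW.
Qed.

Lemma continuous_iprim f : tame f -> continuous (iprim f).
Proof.
move=> tf x; have [_ [M fM] _] := tf.
have M0 : 0 <= M by exact: le_trans (fM 0).
apply/cvgrPdist_le => e e0; near=> y.
have yx : `|x - y| < e / (M + 1).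
  by near: y; apply: cvgr_dist_lt => //; rewrite divr_gt0// ltr_wpDl.
have : `|iprim f x - iprim f y| <= M * `|x - y|.
  have [xy|/ltW yx'] := leP y x; first by rewrite [X in _ * X]ger0_norm ?subr_ge0// iprim_lip.
  by rewrite distrC [X in _ * X]distrC [X in _ * X]ger0_norm ?subr_ge0// iprim_lip.
move/le_trans; apply; move: yx; rewrite ltr_pdivlMr ?ltr_wpDl// => /ltW.
apply: le_trans; rewrite mulrC; apply: ler_wpM2l => //; by rewrite lerDl.
Unshelve. all: by end_near. Qed.

Lemma continuous_steklov f h : tame f -> continuous (steklov f h).
Proof.
move=> tf x; apply: cvgM; last exact: cvg_cst.
apply: cvgB; last exact: continuous_iprim.
apply: (@continuous_comp _ _ _ (fun x => x + h) (iprim f)); last exact: continuous_iprim.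
by apply: cvgD; [exact: cvg_id|exact: cvg_cst].
Qed.

Lemma tame_steklov f h : tame f -> 0 < h -> tame (steklov f h).
Proof.
move=> tf h0; have [mf [M fM] [m f0]] := tf; split.
- by apply: continuous_measurable_fun; exact: continuous_steklov.
- by exists M => x; exact: steklov_bound.
- exists (m - h) => x xm; rewrite /steklov iprimB ?lerDl ?ltW//.
  rewrite (_ : Rintegral _ _ _ = \int[mu]_(t in `]x, x + h]) (cst 0 t)).
    by rewrite /Rintegral integral0 mul0r.
  apply: eq_Rintegral => t; rewrite inE/= in_itv/= => /andP[_ tx].
  by rewrite f0//; lra.
Qed.

Lemma tame_L2 f : tame f -> L2 f.
Proof.
move=> [mf [M fM] _]; apply: (@L2_bounded _ _ M) => //.
exact: measurable_funS mf.
Qed.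

(** Lebesgue's differentiation theorem. *)
Lemma steklov_cvg f : tame f ->
  {ae mu, forall x, steklov f n.+1%:R^-1 x @[n --> \oo] --> f x}.
Proof.
move=> tf; have [mf [M fM] [m f0]] := tf.
have lf : locally_integrable setT f.
  split => //; first exact: openT.
  move=> K _ cK.
  have mK : measurable (K : set (measurableTypeR R)) by exact: compact_measurable.
  have fK : mu.-integrable K (EFin \o f).
    apply: measurable_bounded_integrable => //.
    - exact: compact_finite_measure.
    - exact: measurable_funS mf.
    - exists M; split; first exact: num_real.
      by move=> y My x _ /=; rewrite (le_trans (fM x))// ltW.
  by case/integrableP : fK.
have := FTC1Ny (fun y => tame_integrable y tf) lf.
apply: filterS; first exact: (ae_filter_ringOfSetsType mu).
move=> x [dF F'].
have cF : h^-1 *: (iprim f (h *: (1 : R) + x) - iprim f x) @[h --> 0^'] --> f x.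
  by rewrite -F' derive1E; exact: dF.
have c0 : (n.+1%:R : R)^-1 @[n --> \oo] --> (0 : R)^'.
  move=> A /= [d /= d0 dA]; suff: \forall n \near \oo, A (n.+1%:R^-1) by [].
  near=> n; apply: dA => /=.
    by rewrite sub0r normrN gtr0_norm ?invr_gt0//; near: n; exact: near_invS_lt.
  by rewrite invr_eq0 pnatr_eq0.
have := cvg_comp _ _ c0 cF; apply: cvg_trans; apply: near_eq_cvg; near=> n.
by rewrite /= /steklov mulrC [_ *: (1 : R)]mulr1 (addrC x).
Unshelve. all: by end_near. Qed.

Lemma steklov_C1 f h : tame f -> continuous f -> 0 < h ->
  C1 (steklov f h) (fun x => (f (x + h) - f x) / h).
Proof.
move=> tf cf h0 x _; split; last first.
  apply: cvgM; last exact: cvg_cst.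
  apply: cvgB; last exact: cf.
  apply: (@continuous_comp _ _ _ (fun x => x + h) f); last exact: cf.
  by apply: cvgD; [exact: cvg_id|exact: cvg_cst].
have dF (y : R) : is_derive y 1 (iprim f) (f y).
  have y1 : y < y + 1 by rewrite ltrDl.
  have [dF F'] := continuous_FTC1 y1 (tame_integrable _ tf) (ltNyr y) (cf y).
  by apply: DeriveDef; [exact: dF|rewrite -F' derive1E].
have dFh : is_derive x 1 (fun x => iprim f (x + h)) (f (x + h)).
  have := @is_derive1_comp _ (iprim f) (shift h) x _ _ (dF (x + h)) (is_derive_shift x 1 h).
  by rewrite mulr1.
have := is_deriveM (is_deriveB dFh (dF x)) (is_derive_cst h^-1 x 1).
rewrite /GRing.scale/= mulr0 add0r => d; apply: (is_derive_eq d).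
by rewrite mulrC.
Qed.

Lemma approx0_steklov f : tame f ->
  (forall n, approx0 (steklov f n.+1%:R^-1)) -> approx0 f.
Proof.
move=> tf af; have [_ [M fM] _] := tf.
have tn n : tame (steklov f n.+1%:R^-1) by apply: tame_steklov => //; rewrite invr_gt0.
apply: (@approx0_dominated _ (fun n => steklov f n.+1%:R^-1) _ (cst (M + M))) => //.
- by move=> n; exact: tame_L2.
- exact: tame_L2.
- exact: L2_cst.
- have := steklov_cvg tf; apply: filterS; first exact: (ae_filter_ringOfSetsType mu).
  by [].
- move=> n x _; apply: (le_trans (ler_normB _ _)); apply: lerD => //.
  by apply: steklov_bound => //; rewrite invr_gt0.
Qed.

(** A first average makes f continuous, a second one makes it C^1. *)
Lemma tame_approx0 f : tame f -> approx0 f.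
Proof.
move=> tf; apply: approx0_steklov => // n.
have h0 : (0 : R) < n.+1%:R^-1 by rewrite invr_gt0.
apply: approx0_steklov; first exact: tame_steklov.
move=> k; apply: C1_approx0; apply: steklov_C1.
- exact: tame_steklov.
- exact: continuous_steklov.
- by rewrite invr_gt0.
Qed.

(** Truncation at height n reduces the claim to bounded functions. *)
Lemma L2_approx0 f : L2 f -> approx0 f.
Proof.
move=> Lf.
pose clip (n : nat) (y : R) := Num.max (- n%:R) (Num.min n%:R y).
pose f_ n := (clip n \o f) \_ I.
have clipM n y : `|clip n y| <= n%:R.
  rewrite /clip ler_norml le_max lexx/= ge_max ge_min lexx andbT.
  by rewrite (le_trans _ (ler0n _ n))// oppr_le0.
have tn n : tame (f_ n).
  split.
  - apply/(measurable_restrictT _ mI).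
    apply: measurable_maxr => //; apply: measurable_minr => //.
    exact: L2_measurable.
  - exists n%:R => x; rewrite /f_ patchE; case: ifP => _; first exact: clipM.
    by rewrite normr0.
  - exists 0 => x x0; rewrite /f_ patchE; case: ifPn => //.
    by rewrite inE/= in_itv/= => /andP[]; rewrite ltNge (ltW x0).
have Labs : L2 (fun x => `|f x|).
  apply/L2P; split; first by apply: measurableT_comp => //; exact: L2_measurable.
  by apply: eq_integrable (L2_sqr_integrable Lf) => // x _ /=; rewrite real_normK ?num_real.
apply: (@approx0_dominated _ f_ _ (fun x => `|f x|)) => //.
- by move=> n; exact: tame_L2.
- apply: aeW => x Ix; apply: cvg_near_cst; near=> n.
  rewrite /f_ patchE mem_set//= /clip.
  have : `|f x| <= n%:R by near: n; exact: nbhs_infty_ger.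
  by rewrite ler_norml => /andP[h1 h2]; rewrite (min_idPr h2) (max_idPr h1).
- move=> n x Ix; rewrite /f_ patchE mem_set//= /clip.
  have n0 : (0 : R) <= n%:R by [].
  rewrite minEle maxEle; move: (f x) => y.
  by case: (leP n%:R y) => h1; case: (leP (- n%:R) _) => h2;
    case: (ger0P y) => h3; rewrite ler_norml; apply/andP; split; lra.
- by move=> n; exact: tame_approx0.
Unshelve. all: by end_near. Qed.
End Steklov.

(** * The energy space *)
Section H1facts.
Context {R : realType}.
Implicit Types (f g u v : R -> R) (a b x : R).
Local Notation I := (`]0%R, 1%R[%classic : set R).

Lemma H1_is_wderiv u : H1 u -> is_wderiv u (wderiv u).
Proof. by move=> [_ [g ug]]; exact: (xgetPex (cst 0) (ex_intro _ g ug)). Qed.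

Lemma H1_L2 u : H1 u -> L2 u.
Proof. by case=> /L2_continuous. Qed.

Lemma wderiv_L2 u : H1 u -> L2 (wderiv u).
Proof. by move/H1_is_wderiv => []. Qed.

Lemma H1_lin a u v : H1 u -> H1 v -> H1 (fun x => a * u x + v x).
Proof.
move=> [cu [g ug]] [cv [h vh]]; split; last first.
  by exists (fun x => a * g x + h x); exact: wderiv_lin.
by move=> x; apply: cvgD; [apply: cvgM; [exact: cvg_cst|exact: cu]|exact: cv].
Qed.

Lemma C1_H1 u g : C1 u g -> H1 u.
Proof.
by move=> ug; split; [have [] := C1_within_continuous ug|exists g; exact: C1_wderiv].
Qed.

(** [wderiv u] and g agree almost everywhere; the factor 2, which is not sharp,
comes from [sqL2D]. *)
Lemma sqL2_wderiv_le u g : H1 u -> is_wderiv u g -> sqL2 (wderiv u) <= 2 * sqL2 g.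
Proof.
move=> Hu ug; have [_ Lg _] := ug; have Lw := wderiv_L2 Hu.
rewrite (@eq_sqL2 _ _ (fun x => (wderiv u x - g x) + g x)); last first.
  by move=> x _; rewrite subrK.
apply: (le_trans (sqL2D (L2B Lw Lg) Lg)).
by rewrite (wderiv_unique (proj1 Hu) (H1_is_wderiv Hu) ug) add0r.
Qed.

Lemma H1_increment u a b : H1 u -> 0 <= a <= 1 -> 0 <= b <= 1 ->
  u b - u a = prim (wderiv u) b - prim (wderiv u) a.
Proof. by move=> Hu; apply: wderiv_increment; [exact: (proj1 Hu)|exact: H1_is_wderiv]. Qed.

Lemma sqL2_le_bound f M : measurable_fun I f -> (forall x, I x -> f x ^+ 2 <= M) -> sqL2 f <= M.
Proof.
move=> mf fM.
have M0 : 0 <= M.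
  by apply: le_trans (fM 2^-1 _); rewrite ?sqr_ge0//= in_itv/=; lra.
have Lf : L2 f.
  apply: (@L2_bounded _ _ (Num.sqrt M)) => // x /fM.
  by rewrite -ler_sqrt// sqrtr_sqr.
have -> : M = \int[lebesgue_measure]_(x in I) (cst M x).
  rewrite (Rintegral_cst _ mI) (_ : fine _ = 1) ?mulr1//.
  exact: (congr1 fine muI).
apply: (le_Rintegral mI); [exact: L2_sqr_integrable| |exact: fM].
exact: (L2_integrable (L2_cst M)).
Qed.
Lemma sqL2_lin (a : R) (f g : R -> R) : L2 f -> L2 g ->
  sqL2 (fun x => a * f x + g x) <= 2 * (a ^+ 2 * sqL2 f + sqL2 g).
Proof. by move=> Lf Lg; rewrite -sqL2Z//; apply: sqL2D => //; exact: L2Z. Qed.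

Definition edge_energy (u v : R -> R) := sqL2 u + sqL2 (wderiv u) + sqL2 v.

Lemma edge_energy_lin a (u1 v1 u2 v2 : R -> R) : H1 u1 -> L2 v1 -> H1 u2 -> L2 v2 ->
  edge_energy (fun x => a * u1 x + u2 x) (fun x => a * v1 x + v2 x) <=
  4 * (a ^+ 2 * edge_energy u1 v1 + edge_energy u2 v2).
Proof.
move=> Hu1 Lv1 Hu2 Lv2; rewrite /edge_energy.
have h1 := sqL2_lin a (H1_L2 Hu1) (H1_L2 Hu2).
have h2 := sqL2_lin a Lv1 Lv2.
have h3 := sqL2_lin a (wderiv_L2 Hu1) (wderiv_L2 Hu2).
have h4 := sqL2_wderiv_le (H1_lin a Hu1 Hu2)
  (wderiv_lin a (H1_is_wderiv Hu1) (H1_is_wderiv Hu2)).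
have p1 := mulr_ge0 (sqr_ge0 a) (sqL2_ge0 u1).
have p2 := mulr_ge0 (sqr_ge0 a) (sqL2_ge0 v1).
have p3 := sqL2_ge0 u2; have p4 := sqL2_ge0 v2.
move: h1 h2 h3 h4 p1 p2 p3 p4.
move: (sqL2 (fun x => a * u1 x + u2 x)) (sqL2 (fun x => a * v1 x + v2 x)) => x1 x2.
move: (sqL2 (wderiv (fun x => a * u1 x + u2 x))) => x3.
move: (sqL2 (fun x => a * wderiv u1 x + wderiv u2 x)) => x4.
move: (sqL2 (wderiv u1)) (sqL2 (wderiv u2)) => x5 x6.
move: (sqL2 u1) (sqL2 u2) (sqL2 v1) (sqL2 v2) (a ^+ 2) => x7 x8 x9 x10 A.
rewrite !mulrDr; move: (A * x5) (A * x7) (A * x9) => y5 y7 y9.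
lra.
Qed.
End H1facts.

Section StateSpace.
Context {R : realType} {n : nat}.
Variable init : 'I_n.+1 -> 'I_n.+2.
Implicit Types (U V : state R n).
Local Notation I := (`]0%R, 1%R[%classic : set R).

Local Notation H := (@stateH R n init).

Definition energy U := \sum_i edge_energy (U.1 i) (U.2 i).

Lemma stateH_lin a U V : H U -> H V -> H (a *: U + V).
Proof.
move=> [U1 U2 U3] [V1 V2 V3]; split.
- by move=> i; exact: (H1_lin a (U1 i) (V1 i)).
- by move=> i; exact: (L2D (L2Z a (U2 i)) (V2 i)).
- by move=> i j m ij; rewrite /= !fctE (U3 i j)// (V3 i j).
Qed.

Lemma energy_ge0 U : 0 <= energy U.
Proof. by apply: sumr_ge0 => i _; rewrite !addr_ge0 ?sqL2_ge0. Qed.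

Lemma normH_sqr U : H U -> normH U ^+ 2 = energy U.
Proof.
move=> [U1 U2 _]; rewrite /normH.
rewrite (_ : \sum_i _ = energy U) ?sqr_sqrtr ?energy_ge0//.
apply: eq_bigr => i _.
by rewrite /edge_energy (normL2E (H1_L2 (U1 i))) (normL2E (wderiv_L2 (U1 i))) (normL2E (U2 i)).
Qed.

Lemma normH_ge0 U : 0 <= normH U.
Proof. exact: sqrtr_ge0. Qed.

Lemma energy_lin a U V : H U -> H V ->
  energy (a *: U + V) <= 4 * (a ^+ 2 * energy U + energy V).
Proof.
move=> [U1 U2 _] [V1 V2 _]; rewrite /energy.
have le i : edge_energy ((a *: U + V).1 i) ((a *: U + V).2 i) <=
    4 * (a ^+ 2 * edge_energy (U.1 i) (U.2 i) + edge_energy (V.1 i) (V.2 i)).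
  exact: (edge_energy_lin a (U1 i) (U2 i) (V1 i) (V2 i)).
apply: (le_trans (ler_sum _ (fun i _ => le i))).
by rewrite -mulr_sumr big_split -mulr_sumr.
Qed.

Lemma normH_lin a U V : H U -> H V ->
  normH (a *: U + V) <= 2 * (`|a| * normH U + normH V).
Proof.
move=> HU HV.
have N0 := normH_ge0; have aN : 0 <= `|a| * normH U by rewrite mulr_ge0.
rewrite -(@ler_pXn2r _ 2) ?nnegrE ?mulr_ge0 ?addr_ge0//.
rewrite normH_sqr; last exact: stateH_lin.
apply: (le_trans (energy_lin a HU HV)).
rewrite -!normH_sqr// -(real_normK (num_real a)) -exprMn exprMn.
have := N0 V; nra.
Qed.

Lemma normH0 : normH (0 : state R n) = 0.
Proof.
have D0 : is_wderiv (cst 0 : R -> R) (cst 0).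
  apply: C1_wderiv => x _; split; last exact: cvg_cst.
  exact: is_derive_cst.
have H0 : H1 (cst 0 : R -> R) by split; [exact: cst_continuous|exists (cst 0)].
have s0 : sqL2 (cst 0 : R -> R) = 0.
  apply/eqP; rewrite eq_le sqL2_ge0 andbT; apply: sqL2_le_bound => // x _.
  by rewrite expr0n.
have H0' : H 0.
  by split => [i|i|i j _ _]; [exact: H0|exact: L2_cst|].
apply/eqP; rewrite -sqrf_eq0 normH_sqr// /energy big1// => i _; rewrite /edge_energy.
rewrite -[(0 : state R n).1 i]/(cst 0) -[(0 : state R n).2 i]/(cst 0) s0 addr0 add0r.
apply/eqP; rewrite eq_le sqL2_ge0 andbT.
by have := sqL2_wderiv_le H0 D0; rewrite s0 mulr0.
Qed.

Lemma stateH_sqL2 U i : H U -> [/\ sqL2 (U.1 i) <= normH U ^+ 2,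
  sqL2 (wderiv (U.1 i)) <= normH U ^+ 2 & sqL2 (U.2 i) <= normH U ^+ 2].
Proof.
move=> HU; rewrite normH_sqr// /energy (bigD1 i)//= /edge_energy.
set r := (X in _ + X).
have r0 : 0 <= r by apply: sumr_ge0 => j _; rewrite !addr_ge0 ?sqL2_ge0.
have p1 := sqL2_ge0 (U.1 i); have p2 := sqL2_ge0 (wderiv (U.1 i)).
have p3 := sqL2_ge0 (U.2 i).
by split; lra.
Qed.

(** Turns squared bounds into the square root modulus of continuity used in
[moving_functional]. *)
Lemma sqr_le_sqrt (y d N : R) : 0 <= N -> 0 <= d -> y ^+ 2 <= d * N ^+ 2 ->
  `|y| <= Num.sqrt d * N.
Proof.
move=> N0 d0 h; rewrite -(@ler_pXn2r _ 2) ?nnegrE ?mulr_ge0 ?sqrtr_ge0//.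
by rewrite exprMn sqr_sqrtr// real_normK ?num_real.
Qed.

Lemma displacement_bound U i a b : H U -> 0 <= a <= 1 -> 0 <= b <= 1 ->
  `|U.1 i b - U.1 i a| <= Num.sqrt `|b - a| * normH U.
Proof.
move=> HU a01 b01; have [_ h _] := stateH_sqL2 i HU; have [U1 _ _] := HU.
apply: sqr_le_sqrt; rewrite ?normH_ge0// (H1_increment (U1 i))//.
by apply: (le_trans (sqr_primB_le (wderiv_L2 (U1 i)) a01 b01)); apply: ler_wpM2l.
Qed.

Lemma momentum_bound U i a b : H U -> 0 <= a <= 1 -> 0 <= b <= 1 ->
  `|prim (U.2 i) b - prim (U.2 i) a| <= Num.sqrt `|b - a| * normH U.
Proof.
move=> HU a01 b01; have [_ _ h] := stateH_sqL2 i HU; have [_ U2 _] := HU.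
apply: sqr_le_sqrt; rewrite ?normH_ge0//.
by apply: (le_trans (sqr_primB_le (U2 i) a01 b01)); apply: ler_wpM2l.
Qed.

Lemma mean_bound U i : H U -> `|prim (U.1 i) 1| <= normH U.
Proof.
move=> HU; have [h _ _] := stateH_sqL2 i HU; have [U1 _ _] := HU.
have z01 : 0 <= (0 : R) <= 1 by rewrite lexx ler01.
have o01 : 0 <= (1 : R) <= 1 by rewrite lexx ler01.
have h2 := sqr_primB_le (H1_L2 (U1 i)) z01 o01.
rewrite prim0 !subr0 normr1 mul1r in h2.
have := @sqr_le_sqrt (prim (U.1 i) 1) 1 (normH U) (normH_ge0 U) ler01.
by rewrite sqrtr1 !mul1r; apply; exact: le_trans h2 h.
Qed.
End StateSpace.

(** * Density of the domain of the wave operator *)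
Section DomainDense.
Context {R : realType} {n : nat}.
Variables (init : 'I_n.+1 -> 'I_n.+2) (c : 'I_n.+1 -> R) (alpha : 'I_n.+2 -> R).
Implicit Types (f g u v : R -> R) (a b x : R) (U V : state R n).
Local Notation I := (`]0%R, 1%R[%classic : set R).

(** The mean is corrected by a multiple of 6 (x - x^2), which vanishes at both
ends and has integral 1.  With the exact mean, the primitive of an approximant of
u_x that starts at u(0) also ends at u(1). *)
Lemma L2_approx0_mean f : L2 f -> forall e, 0 < e -> exists u g,
  [/\ C1 u g, u 0 = 0, u 1 = 0, prim u 1 = prim f 1 & sqL2 (fun x => f x - u x) < e].
Proof.
move=> Lf e e0; have e8 : 0 < e / 8 by lra.
have [p [dp [pdp p0 p1 fp]]] := L2_approx0 Lf e8.
have Lp := C1_L2 pdp.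
pose k := prim (fun x => f x - p x) 1.
have kE : k = prim f 1 - prim p 1.
  rewrite /k -mulN1r -primZ// -primD//; last exact: L2Z.
  by apply: eq_Rintegral => x _; rewrite mulN1r.
have k2 : k ^+ 2 <= sqL2 (fun x => f x - p x).
  have := @sqr_primB_le _ _ 0 1 (L2B Lf Lp).
  by rewrite prim0 !subr0 normr1 mul1r !lexx !ler01; apply.
pose q x : R := 6 * (x - x ^+ 2).
pose dq x : R := 6 * (1 - 2 * x).
have qdq x : is_derive x 1 q (dq x).
  apply: (@is_derive_quadratic _ _ _ _ 6) => h.
  have -> : q (x + h) - q x - h * dq x = - (6 * h ^+ 2) by rewrite /q /dq; ring.
  by rewrite normrN ger0_norm// mulr_ge0// sqr_ge0.
have cdq : continuous dq.
  move=> x; apply: cvgM; first exact: cvg_cst.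
  by apply: cvgB; [exact: cvg_cst|apply: cvgM; [exact: cvg_cst|exact: cvg_id]].
have cq : continuous q by move=> x; apply: is_derive_continuous (qdq x).
have Lq : L2 q by apply/L2_continuous/continuous_subspaceT.
have q1 : prim q 1 = 1.
  pose r x : R := 3 * x ^+ 2 - 2 * x ^+ 3.
  have rq x : is_derive x 1 r (q x).
    have d1 := is_derive_id x (1 : R).
    have d2 := is_deriveX 2 d1; have d3 := is_deriveX 3 d1.
    have d4 := is_deriveB (is_deriveZ 3 d2) (is_deriveZ 2 d3).
    rewrite (_ : r = 3 \*: id ^+ 2 - 2 \*: id ^+ 3); last by apply/funext => y.
    by apply: (is_derive_eq d4); rewrite /q /GRing.scale/=; ring.
  by rewrite /prim (Rintegral_derivative rq cq) /r; ring.
have sq : sqL2 q <= 9 / 4.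
  apply: sqL2_le_bound; first exact: L2_measurable.
  move=> x; rewrite /= in_itv/= => /andP[x0 x1].
  have h1 : 0 <= q x by rewrite /q; nra.
  have h2 : q x <= 3 / 2 by rewrite /q; have := sqr_ge0 (2 * x - 1); nra.
  nra.
exists (fun x => k * q x + p x), (fun x => k * dq x + dp x); split.
- move=> x x01; have [dpx cpx] := pdp x x01; split.
    have dz := is_deriveZ k (qdq x).
    exact: is_deriveD dz dpx.
  by apply: cvgD => //; apply: cvgM; [exact: cvg_cst|exact: cdq].
- by rewrite p0 /q; ring.
- by rewrite p1 /q; ring.
- rewrite primD//; last exact: L2Z.
  by rewrite primZ// q1 kE; ring.
- rewrite (@eq_sqL2 _ _ (fun x => (f x - p x) + (- k) * q x)); last by move=> x _; ring.
  apply: (le_lt_trans (sqL2D (L2B Lf Lp) (L2Z (- k) Lq))).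
  rewrite sqL2Z// sqrrN.
  have k0 := sqr_ge0 k; have s0 := sqL2_ge0 q.
  have : k ^+ 2 * sqL2 q <= e / 8 * (9 / 4) by apply: ler_pM => //; lra.
  lra.
Qed.

(** At the nodes the approximants have the values of u, while their u_x and v
vanish there: every boundary and node condition holds trivially, whatever the
coefficients are. *)
Lemma domain_dense U : stateH init U -> forall e, 0 < e -> exists U' W,
  [/\ stateH init U', stateH init W, wave_operator init c alpha U' W & normH (U - U') < e].
Proof.
move=> HU e e0; have [U1 U2 U3] := HU.
(* Each of the n + 1 edges contributes less than d + 2d + d to the squared norm. *)
pose d := e ^+ 2 / (4 * n.+1%:R).
have d0 : 0 < d by rewrite divr_gt0 ?exprn_gt0 ?mulr_gt0 ?ltr0n.
have /choice[v hv] : forall i, exists u, exists g,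
    [/\ C1 u g, u 0 = 0, u 1 = 0 & sqL2 (fun x => U.2 i x - u x) < d].
  by move=> i; exact: L2_approx0 (U2 i) _ d0.
have /choice[g hg] : forall i, exists u, exists g,
    [/\ C1 u g, u 0 = 0, u 1 = 0, prim u 1 = prim (wderiv (U.1 i)) 1
       & sqL2 (fun x => wderiv (U.1 i) x - u x) < d].
  by move=> i; exact: L2_approx0_mean (wderiv_L2 (U1 i)) _ d0.
have /choice[dv {}hv] := hv; have /choice[dg {}hg] := hg.
pose u i x := U.1 i 0 + prim (g i) x.
have cg i : {within `[0%R, 1%R], continuous g i}.
  by have [/C1_within_continuous[]] := hg i.
have Lg i : L2 (g i) by exact: L2_continuous.
have ug i : is_wderiv (u i) (g i).
  have c0 : is_wderiv (cst (U.1 i 0) : R -> R) (cst 0).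
    by apply: C1_wderiv => x _; split; [exact: is_derive_cst|exact: cvg_cst].
  have := wderiv_lin 1 c0 (prim_wderiv (@cg i)).
  by congr is_wderiv; apply/funext => x; rewrite /= mul1r ?add0r.
have H1u i : H1 (u i).
  split; last by exists (g i).
  by move=> x; apply: cvgD; [exact: cvg_cst|exact: continuous_prim].
have H1v i : H1 (v i) by have [/C1_H1] := hv i.
have H1g i : H1 (g i) by have [/C1_H1] := hg i.
have u0 i : u i 0 = U.1 i 0 by rewrite /u prim0 addr0.
have u1 i : u i 1 = U.1 i 1.
  have [_ _ _ h _] := hg i.
  have := @H1_increment _ _ 0 1 (U1 i); rewrite prim0 !lexx !ler01 => /(_ isT isT).
  rewrite /u h; lra.
have ncu : continuous_at_nodes init u.
  by move=> i j m ij; rewrite u0 u1; exact: (U3 i j m ij).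
have ncv : continuous_at_nodes init v.
  by move=> i j m ij; have [_ _ -> _] := hv i; have [_ -> _ _] := hv j.
have HU' : stateH init (u, v).
  by split => [i|i|]; [exact: H1u|exact: H1_L2 (H1v i)|exact: ncu].
exists (u, v), (v, fun i x => c i ^+ 2 * dg i x); split => //.
- split => [i|i|]; [exact: H1v| |exact: ncv].
  by apply: L2Z; have [/C1_wderiv[]] := hg i.
- exists u, v, g, dg; split; last 2 first.
  + by rewrite /same subrr normH0.
  + by rewrite /same subrr normH0.
  split.
  + move=> i; split; [exact: H1u|exact: ug|exact: H1g| |exact: H1v].
    by have [/C1_wderiv] := hg i.
  + by split; [exact: ncu|exact: ncv].
  + by move=> i _; have [_ _ -> _ _] := hg i; have [_ _ -> _] := hv i; rewrite mulr0 oppr0.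
  + by have [_ -> _ _ _] := hg ord0; have [_ -> _ _] := hv ord0; rewrite mulr0.
  + move=> i _; rewrite big1; last first.
      by move=> j _; have [_ -> _ _ _] := hg j; rewrite mulr0.
    by have [_ _ -> _ _] := hg i; have [_ _ -> _] := hv i; rewrite !mulr0 subr0.
have HD : stateH init (U - (u, v)).
  have := stateH_lin (-1) HU' HU; by rewrite scaleN1r addrC.
rewrite -(@ltr_pXn2r _ 2) ?nnegrE ?normH_ge0 ?(ltW e0)//.
rewrite (normH_sqr HD) /energy.
have -> : e ^+ 2 = \sum_(i < n.+1) (4 * d).
  have k0 : (n.+1%:R : R) != 0 by rewrite pnatr_eq0.
  by rewrite sumr_const card_ord /d -[RHS]mulr_natr; move: (n.+1%:R : R) k0 => k k0; field.
apply: ltr_sum; first by apply/hasP; exists ord0 => //; rewrite mem_index_enum.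
move=> i _; rewrite /edge_energy.
have [_ _ _ hvi] := hv i; have [_ _ _ _ hgi] := hg i.
have Lw := wderiv_L2 (U1 i).
have -> : (U - (u, v)).1 i = (fun x => U.1 i x - u i x) by [].
have -> : (U - (u, v)).2 i = (fun x => U.2 i x - v i x) by [].
have H1d : H1 (fun x => U.1 i x - u i x).
  have := H1_lin (-1) (H1u i) (U1 i); congr H1; apply/funext => x; ring.
have wd : is_wderiv (fun x => U.1 i x - u i x) (fun x => wderiv (U.1 i) x - g i x).
  have := wderiv_lin (-1) (ug i) (H1_is_wderiv (U1 i)).
  by congr is_wderiv; apply/funext => x; ring.
have h2 := sqL2_wderiv_le H1d wd.
have h1 : sqL2 (fun x => U.1 i x - u i x) <= sqL2 (fun x => wderiv (U.1 i) x - g i x).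
  apply: sqL2_le_bound; first by apply: L2_measurable; exact: H1_L2.
  move=> x; rewrite /= in_itv/= => /andP[/ltW x0 /ltW x1].
  have z01 : 0 <= (0 : R) <= 1 by rewrite lexx ler01.
  have x01 : 0 <= x <= 1 by rewrite x0.
  have := wderiv_increment (proj1 H1d) wd z01 x01.
  rewrite u0 subrr subr0 => ->.
  apply: (le_trans (sqr_primB_le (L2B Lw (Lg i)) z01 x01)).
  by rewrite subr0 ger0_norm// ler_piMl// sqL2_ge0.
have := sqL2_ge0 (fun x => U.1 i x - u i x); lra.
Qed.
End DomainDense.

(** * Continuous functions with zero right derivative *)
Section RealAnalysis.
Context {R : realType}.

Lemma cvg0_at_right0P (f : R -> R) : f h @[h --> 0^'+] --> (0 : R) <->
  forall e, 0 < e -> exists2 d, 0 < d & forall h, 0 < h < d -> `|f h| < e.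
Proof.
split.
- move=> cf e e0; move/cvgrPdist_lt : cf => /(_ e e0) [d /= d0 df].
  exists d => // h /andP[h0 hd]; rewrite -[`|_|]normrN -sub0r; apply: df => //=.
  by rewrite sub0r normrN gtr0_norm.
- move=> fe; apply/cvgrPdist_lt => e e0; have [d d0 df] := fe e e0.
  exists d => // h /=; rewrite !sub0r !normrN => hd h0.
  by apply: df; rewrite h0/=; rewrite gtr0_norm in hd.
Qed.

(** For each e > 0 the set of times where the increment from a is at most
e (t - a) is closed, and cannot stop before b. *)
Lemma eq_of_right_derivative0 (f : R -> R) a b : a <= b ->
  (forall t, a <= t <= b -> forall e, 0 < e -> exists2 d, 0 < d &
     forall s, a <= s <= b -> `|s - t| < d -> `|f s - f t| < e) ->
  (forall t, a <= t -> t < b -> forall e, 0 < e -> exists2 d, 0 < d &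
     forall h, 0 < h < d -> t + h <= b -> `|f (t + h) - f t| <= e * h) ->
  f b = f a.
Proof.
move=> ab fc fd; apply/eqP; rewrite -subr_eq0 -normr_le0; apply/ler_addgt0Pr => e' e'0.
rewrite add0r.
have ba1 : 0 < b - a + 1 by rewrite ltr_wpDl ?subr_ge0.
pose e := e' / (b - a + 1).
have e0 : 0 < e by rewrite divr_gt0.
suff h : `|f b - f a| <= e * (b - a).
  apply: (le_trans h); rewrite /e mulrAC ler_pdivrMr//; apply: ler_wpM2l; first exact: ltW.
  by rewrite lerDl.
pose A := [set t | a <= t <= b /\ `|f t - f a| <= e * (t - a)].
have Aa : A a by split; rewrite ?lexx ?ab// !subrr normr0 mulr0.
have hA : has_sup A by split; [exists a|exists b => t [/andP[]]].
have s0b : sup A <= b by apply: ge_sup; [exists a|move=> t [/andP[]]].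
have as0 : a <= sup A by apply: ub_le_sup => //; case: hA.
have As0 : `|f (sup A) - f a| <= e * (sup A - a).
  rewrite leNgt; apply/negP => h.
  have eta0 : 0 < `|f (sup A) - f a| - e * (sup A - a) by rewrite subr_gt0.
  have [d d0 df] := fc (sup A) ltac:(by rewrite as0 s0b) _ eta0.
  have [s [/andP[sa sb] As] ssup] := sup_adherent d0 hA.
  have ssup' : s <= sup A by apply: ub_le_sup; [case: hA|split; rewrite ?sa].
  have := df s ltac:(by rewrite sa sb).
  rewrite distrC ger0_norm ?subr_ge0// ltrBlDr addrC -ltrBlDr => /(_ ssup) fs.
  have : `|f (sup A) - f a| <= `|f s - f (sup A)| + `|f s - f a|.
    by have := ler_distD (f s) (f (sup A)) (f a); rewrite (distrC _ (f s)).
  have : e * (s - a) <= e * (sup A - a) by apply: ler_wpM2l; [exact: ltW|lra].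
  lra.
have [->//|neq] := eqVneq b (sup A).
have s0b' : sup A < b by rewrite lt_neqAle eq_sym neq.
have [d d0 df] := fd _ as0 s0b' e e0.
pose h := Num.min (d / 2) (b - sup A).
have h0 : 0 < h by rewrite lt_min divr_gt0//= subr_gt0.
have hd : h < d by rewrite gt_min; apply/orP; left; lra.
have hb : sup A + h <= b by rewrite -lerBrDl ge_min lexx orbT.
have := df h ltac:(by rewrite h0) hb => fh.
have : A (sup A + h).
  split; first by rewrite hb andbT; lra.
  have : `|f (sup A + h) - f a| <= `|f (sup A + h) - f (sup A)| + `|f (sup A) - f a|.
    exact: ler_distD.
  lra.
by move=> /(ub_le_sup (proj2 hA)); rewrite gerDl leNgt h0.
Qed.
End RealAnalysis.

(** * Quasi-seminorms and bounded functionals *)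
Section QuasiNorm.
Context {R : realType} {E : lmodType R}.

(** The constant 2 costs nothing in limit arguments and allows the energy norm to
be handled through inequalities between squares. *)
Record quasi_seminorm (H : set E) (N : E -> R) : Prop := {
  quasi_lin : forall a x y, H x -> H y -> H (a *: x + y);
  quasi_ge0 : forall x, 0 <= N x;
  quasi_zero : N 0 = 0;
  quasi_le : forall (a : R) x y, H x -> H y ->
    N (a *: x + y) <= 2 * (`|a| * N x + N y)
}.

Context (H : set E) (N : E -> R) (q : quasi_seminorm H N).
Implicit Types x y z : E.

Lemma quasi_mem0 x : H x -> H 0.
Proof. by move=> Hx; have := quasi_lin q (-1) Hx Hx; rewrite scaleN1r addNr. Qed.

Lemma quasi_memZ a x : H x -> H (a *: x).
Proof. by move=> Hx; have := quasi_lin q a Hx (quasi_mem0 Hx); rewrite addr0. Qed.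

Lemma quasi_memD x y : H x -> H y -> H (x + y).
Proof. by move=> Hx Hy; have := quasi_lin q 1 Hx Hy; rewrite scale1r. Qed.

Lemma quasi_memB x y : H x -> H y -> H (x - y).
Proof. by move=> Hx Hy; have := quasi_lin q (-1) Hy Hx; rewrite scaleN1r addrC. Qed.

Lemma quasiD x y : H x -> H y -> N (x + y) <= 2 * (N x + N y).
Proof. by move=> Hx Hy; have := quasi_le q 1 Hx Hy; rewrite scale1r normr1 mul1r. Qed.

Lemma quasiZ a x : H x -> N (a *: x) <= 2 * (`|a| * N x).
Proof.
by move=> Hx; have := quasi_le q a Hx (quasi_mem0 Hx); rewrite !addr0 (quasi_zero q) addr0.
Qed.

Lemma quasiB_sym x y : H x -> H y -> N (x - y) <= 2 * N (y - x).
Proof.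
move=> Hx Hy; have := quasiZ (-1) (quasi_memB Hy Hx).
by rewrite scaleN1r opprB normrN1 mul1r.
Qed.

Lemma quasi_triangle x y z : H x -> H y -> H z ->
  N (x - z) <= 2 * (N (x - y) + N (y - z)).
Proof.
move=> Hx Hy Hz; rewrite -(subrKA y); exact: quasiD (quasi_memB Hx Hy) (quasi_memB Hy Hz).
Qed.

(** Identities between states hold modulo [null] elements, which form a linear
subspace. *)
Definition null x := H x /\ N x = 0.

Lemma null_lin a x y : null x -> null y -> null (a *: x + y).
Proof.
move=> [Hx x0] [Hy y0]; split; first exact: (quasi_lin q).
apply/eqP; rewrite eq_le (quasi_ge0 q) andbT.
by have := quasi_le q a Hx Hy; rewrite x0 y0 mulr0 addr0 mulr0.
Qed.

Lemma nullD x y : null x -> null y -> null (x + y).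
Proof. by move=> nx ny; have := null_lin 1 nx ny; rewrite scale1r. Qed.

Lemma null0 x : H x -> null 0.
Proof. by move=> Hx; split; [exact: quasi_mem0 Hx|exact: quasi_zero q]. Qed.

Lemma nullZ a x : null x -> null (a *: x).
Proof. by move=> nx; have := null_lin a nx (null0 (proj1 nx)); rewrite addr0. Qed.

Lemma nullN x : null x -> null (- x).
Proof. by move/(nullZ (-1)); rewrite scaleN1r. Qed.

Lemma null_le x y : null (x - y) -> H x -> H y -> N x <= 2 * N y.
Proof.
move=> [Hxy xy0] Hx Hy; have := quasiD Hxy Hy; by rewrite subrK xy0 add0r.
Qed.

Definition bounded_functional (l : E -> R) :=
  (forall a x y, H x -> H y -> l (a *: x + y) = a * l x + l y) /\
  exists2 K, 0 <= K & forall x, H x -> `|l x| <= K * N x.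

Lemma functionalB l x y : bounded_functional l -> H x -> H y -> l (x - y) = l x - l y.
Proof.
move=> [ll _] Hx Hy; have := ll (-1) y x Hy Hx.
by rewrite scaleN1r mulN1r addrC (addrC _ (l x)).
Qed.

Lemma functional_null l x : bounded_functional l -> null x -> l x = 0.
Proof.
move=> [_ [K K0 lK]] [Hx x0]; apply/eqP; rewrite -normr_le0.
by have := lK x Hx; rewrite x0 mulr0.
Qed.

Lemma functional_same l x y : bounded_functional l -> H x -> H y -> same N x y -> l x = l y.
Proof.
move=> bl Hx Hy xy; apply/eqP; rewrite -subr_eq0 -functionalB//; apply/eqP.
by apply: functional_null => //; split => //; exact: quasi_memB.
Qed.
End QuasiNorm.

(** * Orbits of strongly continuous semigroups *)
Section SemigroupFacts.
Context {R : realType} {E : lmodType R} (H : set E) (N : E -> R).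
Context (q : quasi_seminorm H N) (S : R -> E -> E) (hS : C0_semigroup H N S).
Implicit Types (x y z : E) (t h s : R).

Let HS t x : 0 <= t -> H x -> H (S t x). Proof. exact: (C0_stable hS). Qed.

Lemma S_lin t a x y : 0 <= t -> H x -> H y ->
  null H N (S t (a *: x + y) - (a *: S t x + S t y)).
Proof.
move=> t0 Hx Hy; split; last exact: (C0_linear hS).
by apply: (quasi_memB q); [apply: HS => //; exact: (quasi_lin q)|apply: (quasi_lin q); exact: HS].
Qed.

Lemma S_zero t x : 0 <= t -> H x -> null H N (S t 0).
Proof.
move=> t0 Hx; have H0 := quasi_mem0 q Hx.
have := nullN q (S_lin (1) t0 H0 H0).
by rewrite !scale1r addr0 opprB addrK.
Qed.

Lemma S_scale t a x : 0 <= t -> H x -> null H N (S t (a *: x) - a *: S t x).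
Proof.
move=> t0 Hx; have := nullD q (S_lin a t0 Hx (quasi_mem0 q Hx)) (S_zero t0 Hx).
by rewrite addr0 opprD addrA subrK.
Qed.

Lemma S_sub t x y : 0 <= t -> H x -> H y -> null H N (S t (x - y) - (S t x - S t y)).
Proof.
move=> t0 Hx Hy; have := S_lin (-1) t0 Hy Hx.
by rewrite !scaleN1r (addrC (- y)) (addrC (- S t y)).
Qed.

Lemma S_add s t x : 0 <= s -> 0 <= t -> H x -> null H N (S (s + t) x - S s (S t x)).
Proof.
move=> s0 t0 Hx; split; last exact: (C0_add hS).
by apply: (quasi_memB q); apply: HS => //; [exact: addr_ge0|exact: HS].
Qed.

Lemma S_lipschitz t : 0 <= t -> exists2 C, 0 < C &
  forall x y, H x -> H y -> N (S t x - S t y) <= C * N (x - y).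
Proof.
move=> t0; have [M hM] := C0_bounded hS t0.
exists (2 * (`|M| + 1)); first by rewrite mulr_gt0// ltr_wpDl.
move=> x y Hx Hy; have Hxy := quasi_memB q Hx Hy.
have H1 := quasi_memB q (HS t0 Hx) (HS t0 Hy).
have n1 : null H N (S t x - S t y - S t (x - y)).
  by have := nullN q (S_sub t0 Hx Hy); rewrite opprB.
apply: (le_trans (null_le q n1 H1 (HS t0 Hxy))).
rewrite -mulrA; apply: ler_wpM2l => //; apply: (le_trans (hM _ Hxy)).
by apply: ler_wpM2r; [exact: (quasi_ge0 q)|rewrite (le_trans (ler_norm M))// lerDl].
Qed.

Lemma functional_S l t : 0 <= t -> bounded_functional H N l ->
  bounded_functional H N (l \o S t).
Proof.
move=> t0 bl; split.
  move=> a x y Hx Hy /=.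
  have H1 := quasi_lin q a Hx Hy; have [ll _] := bl.
  rewrite -ll; [|exact: HS|exact: HS].
  apply: (functional_same q bl); [exact: HS| |exact: (C0_linear hS)].
  by apply: (quasi_lin q); exact: HS.
have [_ [K K0 lK]] := bl; have [M hM] := C0_bounded hS t0.
exists (K * `|M|); first by rewrite mulr_ge0.
move=> x Hx /=; apply: (le_trans (lK _ (HS t0 Hx))); rewrite -mulrA.
apply: ler_wpM2l => //; apply: (le_trans (hM _ Hx)).
by apply: ler_wpM2r; [exact: (quasi_ge0 q)|exact: ler_norm].
Qed.

(** S t commutes with difference quotients up to null elements, and is
bounded. *)
Lemma generator_S t x y : 0 <= t -> generator H N S x y -> generator H N S (S t x) (S t y).
Proof.
move=> t0 [Hx Hy gxy]; split; [exact: HS|exact: HS|].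
have [C C0 hC] := S_lipschitz t0.
apply/cvg0_at_right0P => e e0.
have e1 : 0 < e / (2 * C) by rewrite divr_gt0// mulr_gt0.
have [d d0 df] := (cvg0_at_right0P _).1 gxy _ e1.
exists d => // h /andP[h0 hd].
have := df h; rewrite h0 hd => /(_ isT).
rewrite !ger0_norm ?(quasi_ge0 q)// ltr_pdivlMr ?mulr_gt0// => lt.
have h0' := ltW h0.
have HSh := HS h0' Hx; have HSt := HS t0 Hx.
set w := h^-1 *: (S h x - x) in lt *.
have Hw : H w by apply: (quasi_memZ q); exact: (quasi_memB q).
pose A := h^-1 *: (S h (S t x) - S t x) - S t y.
have n1 : null H N (A - (S t w - S t y)).
  have e2 := S_scale h^-1 t0 (quasi_memB q HSh Hx).
  have e3 := nullZ q h^-1 (S_sub t0 HSh Hx).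
  have e4 := S_add t0 h0' Hx.
  have e5 := S_add h0' t0 Hx.
  have e6 : null H N (S h (S t x) - S t (S h x)).
    have := nullD q (nullN q e5) e4; rewrite (addrC h t) opprB addrA subrK; exact.
  have := nullD q (nullZ q h^-1 e6) (nullN q (nullD q e2 e3)).
  congr null; rewrite /A.
  rewrite (scalerBr _ (S t _)) addrA subrK opprB addrA -scalerDr addrA subrK.
  by rewrite (opprB (S t w)) addrA subrK.
have HA : H A.
  apply: (quasi_memB q); last exact: HS.
  by apply: (quasi_memZ q); apply: (quasi_memB q) => //; exact: HS.
apply: (le_lt_trans (null_le q n1 HA (quasi_memB q (HS t0 Hw) (HS t0 Hy)))).
by apply: le_lt_trans lt; rewrite mulrCA ler_wpM2l// mulrC hC.
Qed.

Lemma S_right t x : 0 <= t -> H x -> forall e, 0 < e -> exists2 d, 0 < d &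
  forall h, 0 <= h < d -> N (S (t + h) x - S t x) < e.
Proof.
move=> t0 Hx e e0; have [C C0 hC] := S_lipschitz t0.
have e1 : 0 < e / (2 * C) by rewrite divr_gt0// mulr_gt0.
have [d d0 df] := (cvg0_at_right0P _).1 (C0_continuous hS Hx) _ e1.
exists d => // h /andP[]; rewrite le_eqVlt => /predU1P[<- _|h0 hd].
  by rewrite addr0 subrr (quasi_zero q).
have := df h; rewrite h0 hd => /(_ isT).
rewrite ger0_norm ?(quasi_ge0 q)// ltr_pdivlMr ?mulr_gt0//; apply: le_lt_trans.
have h0' := ltW h0; have HSh := HS h0' Hx.
have n1 : null H N (S (t + h) x - S t x - (S t (S h x) - S t x)).
  by have := S_add t0 h0' Hx; congr null; rewrite opprB addrA subrK.
have Hth := HS (addr_ge0 t0 h0') Hx.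
apply: (le_trans (null_le q n1 (quasi_memB q Hth (HS t0 Hx))
  (quasi_memB q (HS t0 HSh) (HS t0 Hx)))).
by rewrite mulrCA ler_wpM2l// mulrC hC.
Qed.

Let dist x s s' := N (S s x - S s' x).

(** Let O k be the set of times around which the orbit oscillates by less than
1 / (k + 1).  It is open, and dense because the orbit is right continuous: a
short interval to the right of any time lies in it.  Baire's theorem gives a time
in all of them. *)
Lemma S_continuity_point x t : H x -> 0 < t -> exists2 r, 0 < r < t &
  forall e, 0 < e -> exists2 d, 0 < d &
    forall s, 0 <= s -> `|s - r| < d -> dist x s r < e.
Proof.
move=> Hx t0.
pose O (k : nat) : set R := [set r | exists2 d, 0 < d & forall s s', 0 <= s -> 0 <= s' ->
  `|s - r| < d -> `|s' - r| < d -> dist x s s' < k.+1%:R^-1].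
have OO k : open (O k) /\ dense (O k).
  split.
  - rewrite openE => r [d d0 hd]; exists (d / 2) => /=; first by rewrite divr_gt0.
    move=> r' /= rr'; exists (d / 2); first by rewrite divr_gt0.
    have tri s : `|s - r'| < d / 2 -> `|s - r| < d.
      move=> sr'; have := ler_distD r' s r; rewrite (distrC r'); lra.
    by move=> s s' s0 s0' sr sr'; apply: hd => //; exact: tri.
  - move=> V [p Vp] oV.
    have /nbhs_ballP[d /= d0 dV] := open_nbhs_nbhs (conj oV Vp).
    (* Negative times belong to O k vacuously. *)
    have [p0|p0] := ltP p 0.
      exists p; split => //; exists (- p); first by rewrite oppr_gt0.
      move=> s s' s0 _; rewrite ltr_norml => /andP[_]; lra.
    have e0 : 0 < (k.+1%:R : R)^-1 / 6 by rewrite divr_gt0// invr_gt0.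
    have [d' d'0 hd'] := S_right p0 Hx e0.
    pose h := Num.min d d' / 2.
    have m0 : 0 < Num.min d d' by rewrite lt_min d0.
    have h0 : 0 < h by rewrite divr_gt0.
    have [h1 h2] : 2 * h <= d /\ 2 * h <= d'.
      by rewrite /h mulrC divfK// !ge_min !lexx orbT.
    exists (p + h); split.
      by apply: dV; rewrite /ball/= opprD addrA subrr sub0r normrN gtr0_norm//; lra.
    exists h => // s s' s0 s0'; rewrite !ltr_norml => /andP[a1 a2] /andP[b1 b2].
    have Hp := HS p0 Hx.
    have b3 := hd' (s - p) ltac:(apply/andP; split; lra).
    have b4 := hd' (s' - p) ltac:(apply/andP; split; lra).
    rewrite addrCA subrr addr0 in b3; rewrite addrCA subrr addr0 in b4.
    apply: (le_lt_trans (quasi_triangle q (HS s0 Hx) Hp (HS s0' Hx))).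
    have := quasiB_sym q Hp (HS s0' Hx).
    by move: ((k.+1%:R)^-1) b3 b4 => K; lra.
have dO := Baire OO.
have nV : `]0, t[%classic !=set0 by exists (t / 2); rewrite /= in_itv/=; lra.
have oV : open (`]0, t[%classic : set R) by exact: interval_open.
have [r [/= + hr]] := dO _ nV oV.
rewrite in_itv/= => r0t; exists r => // e e0.
have /andP[r0 _] := r0t.
have [k _ /(_ k (leqnn k)) hk] : \forall k \near \oo, (k.+1%:R : R)^-1 < e.
  exact: near_infty_natSinv_lt (PosNum e0).
have [d d0 hd] := hr k I; exists d => // s s0 sr.
by apply: lt_trans hk; apply: hd => //; [exact: ltW|rewrite subrr normr0].
Qed.

(** Near t, S s x = S (t - r) (S (s - t + r) x) with r a time of continuity and
S (t - r) a bounded operator. *)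
Lemma S_continuous x t : H x -> 0 <= t -> forall e, 0 < e -> exists2 d, 0 < d &
  forall s, 0 <= s -> `|s - t| < d -> N (S s x - S t x) < e.
Proof.
move=> Hx; rewrite le_eqVlt => /predU1P[<-|t0] e e0.
  have [d d0 hd] := S_right (lexx 0) Hx e0; exists d => // s s0; rewrite subr0.
  by rewrite ger0_norm// => sd; have := hd s; rewrite s0 sd add0r => /(_ isT).
have [r /andP[r0 rt] hr] := S_continuity_point Hx t0.
have tr0 : 0 <= t - r by rewrite subr_ge0 ltW.
have [C C0 hC] := S_lipschitz tr0.
have e1 : 0 < e / (2 * C) by rewrite divr_gt0// mulr_gt0.
have [d d0 hd] := hr _ e1.
exists (Num.min d r); first by rewrite lt_min d0.
move=> s s0; rewrite lt_min => /andP[sd sr].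
pose s1 := s - (t - r).
have s1_ge0 : 0 <= s1 by rewrite /s1; move: sr; rewrite ltr_norml => /andP[? _]; lra.
have := hd s1 s1_ge0; rewrite (_ : s1 - r = s - t); last by rewrite /s1; ring.
move=> /(_ sd); rewrite ltr_pdivlMr ?mulr_gt0//; apply: le_lt_trans.
have r0' := ltW r0.
have n1 : null H N (S s x - S t x - (S (t - r) (S s1 x) - S (t - r) (S r x))).
  have := nullD q (S_add tr0 s1_ge0 Hx) (nullN q (S_add tr0 r0' Hx)).
  have -> : t - r + s1 = s by rewrite /s1 addrC subrK.
  rewrite subrK; congr null.
  by rewrite !opprB (addrC _ (- S t x)) addrACA (addrC (- _) (S (t - r) _)).
have Hs1 := HS s1_ge0 Hx; have Hr := HS r0' Hx; have t0' := ltW t0.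
apply: (le_trans (null_le q n1 (quasi_memB q (HS s0 Hx) (HS t0' Hx))
  (quasi_memB q (HS tr0 Hs1) (HS tr0 Hr)))).
by rewrite mulrCA ler_wpM2l// mulrC hC.
Qed.

Lemma small_sqrt (c e : R) : 0 <= c -> 0 < e -> exists2 d, 0 < d &
  forall h, 0 <= h < d -> c * Num.sqrt h <= e.
Proof.
move=> c0 e0; have c1 : 0 < c + 1 by rewrite ltr_wpDl.
have ec : 0 < e / (c + 1) by rewrite divr_gt0.
exists ((e / (c + 1)) ^+ 2); first by rewrite exprn_gt0.
move=> h /andP[h0 hd].
have : Num.sqrt h <= Num.sqrt ((e / (c + 1)) ^+ 2) by rewrite ler_sqrt ?sqr_ge0// ltW.
rewrite sqrtr_sqr gtr0_norm//.
rewrite ler_pdivlMr// mulrC; apply: le_trans; apply: ler_wpM2r; first exact: sqrtr_ge0.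
by rewrite lerDl.
Qed.

(** With p the moving parameter and U = S t x, the increment of l p U over a time
h splits into the change of p, the change h l(S t y) of U, and a mixed term.  The
mixed term is O(h sqrt h) as l is Hoelder in p and the orbit is Lipschitz to the
right, so it does not enter the derivative. *)
Lemma moving_functional (l : R -> E -> R) (K : R) (P : set R) x y (p0 sg t0 t1 : R) :
  0 <= K -> (forall p, P p -> bounded_functional H N (l p)) ->
  (forall p z, P p -> H z -> `|l p z| <= K * N z) ->
  (forall p p' z, P p -> P p' -> H z -> `|l p' z - l p z| <= K * Num.sqrt `|p' - p| * N z) ->
  generator H N S x y -> 0 <= t0 -> t0 <= t1 ->
  let p t := p0 + sg * (t - t0) in
  (forall t, t0 <= t <= t1 -> P (p t)) ->
  (forall t, t0 <= t -> t < t1 -> forall e, 0 < e -> exists2 d, 0 < d &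
     forall h, 0 < h < d -> t + h <= t1 ->
       `|l (p (t + h)) (S t x) - l (p t) (S t x) + h * l (p t) (S t y)| <= e * h) ->
  l (p t1) (S t1 x) = l (p t0) (S t0 x).
Proof.
move=> K0 bl lK lP gxy t0_ge0 t01 p Pp Dp; have [Hx Hy _] := gxy.
have sg0 : 0 <= Num.sqrt `|sg| by exact: sqrtr_ge0.
have dp s t : Num.sqrt `|p s - p t| = Num.sqrt `|sg| * Num.sqrt `|s - t|.
  by rewrite -sqrtrM// -normrM; congr (Num.sqrt `|_|); rewrite /p; ring.
apply: (@eq_of_right_derivative0 _ (fun t => l (p t) (S t x))) => // t.
- move=> tI e e0; have t_ge0 : 0 <= t by case/andP : tI => + _; apply: le_trans.
  have HU := HS t_ge0 Hx.
  have K1 : 0 < K + 1 by rewrite ltr_wpDl.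
  have e2 : 0 < e / 2 / (K + 1) by rewrite !divr_gt0.
  have [d1 d10 h1] := S_continuous Hx t_ge0 e2.
  have c0 : 0 <= K * Num.sqrt `|sg| * N (S t x) by rewrite !mulr_ge0// (quasi_ge0 q).
  have e4 : 0 < e / 4 by rewrite divr_gt0.
  have [d2 d20 h2] := small_sqrt c0 e4.
  exists (Num.min d1 d2); first by rewrite lt_min d10.
  move=> s sI; rewrite lt_min => /andP[sd1 sd2].
  have s_ge0 : 0 <= s by case/andP : sI => + _; apply: le_trans.
  have HUs := HS s_ge0 Hx.
  have b1 : `|l (p s) (S s x) - l (p s) (S t x)| <= e / 2.
    rewrite -(functionalB (bl _ (Pp _ sI)) HUs HU).
    apply: (le_trans (lK _ _ (Pp _ sI) (quasi_memB q HUs HU))).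
    have := h1 s s_ge0 sd1; rewrite ltr_pdivlMr// => /ltW; apply: le_trans.
    by rewrite mulrC ler_wpM2l ?(quasi_ge0 q)// lerDl.
  have b2 : `|l (p s) (S t x) - l (p t) (S t x)| <= e / 4.
    apply: (le_trans (lP _ _ _ (Pp _ tI) (Pp _ sI) HU)); rewrite dp.
    have := h2 `|s - t|; rewrite normr_ge0 sd2 => /(_ isT); apply: le_trans.
    by rewrite mulrA -!mulrA (mulrC (N _)).
  have := ler_distD (l (p s) (S t x)) (l (p s) (S s x)) (l (p t) (S t x)); lra.
- move=> t0t tt1 e e0; have t_ge0 : 0 <= t by exact: le_trans t0t.
  have HU := HS t_ge0 Hx; have HW := HS t_ge0 Hy.
  have e3 : 0 < e / 3 by rewrite divr_gt0.
  have [d1 d10 h1] := Dp t t0t tt1 _ e3.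
  have c0 : 0 <= K * Num.sqrt `|sg| * N (S t y) by rewrite !mulr_ge0// (quasi_ge0 q).
  have [d2 d20 h2] := small_sqrt c0 e3.
  have [_ _ gU] := generator_S t_ge0 gxy.
  have K1 : 0 < K + 1 by rewrite ltr_wpDl.
  have eK : 0 < e / 3 / (K + 1) by rewrite !divr_gt0.
  have [d3 d30 h3] := (cvg0_at_right0P _).1 gU _ eK.
  exists (Num.min d1 (Num.min d2 d3)); first by rewrite !lt_min d10 d20.
  move=> h /andP[h0]; rewrite !lt_min => /and3P[hd1 hd2 hd3] th1.
  have h0' := ltW h0.
  have tI : t0 <= t <= t1 by rewrite t0t ltW.
  have thI : t0 <= t + h <= t1 by rewrite th1 andbT; lra.
  have Ptt := Pp _ tI; have Pth := Pp _ thI.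
  have HSU := HS h0' HU.
  set U := S t x in HU HSU h1 h3 *; set W := S t y in HW h1 h2 h3 *.
  (* z is the error of the difference quotient, small in quasi-norm. *)
  pose z := h^-1 *: (S h U - U) - W.
  have Hz : H z.
    by apply: (quasi_memB q) => //; apply: (quasi_memZ q); exact: (quasi_memB q).
  have SU : S h U = h *: (W + z) + U.
    by rewrite /z (addrC W) subrK scalerA mulfV ?gt_eqF// scale1r subrK.
  have lU' : l (p (t + h)) (S (t + h) x) =
      h * (l (p (t + h)) W + l (p (t + h)) z) + l (p (t + h)) U.
    have [ll _] := bl _ Pth.
    rewrite (functional_same q (bl _ Pth) _ HSU); last 2 first.
    - by apply: HS => //; exact: addr_ge0.
    - by rewrite addrC; exact: (C0_add hS).
    rewrite SU ll//; last exact: (quasi_memD q).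
    by congr (h * _ + _); have := ll 1 W z HW Hz; rewrite scale1r mul1r.
  have b1 := h1 h ltac:(by rewrite h0 hd1) th1.
  have b2 : `|l (p (t + h)) W - l (p t) W| <= e / 3.
    apply: (le_trans (lP _ _ _ Ptt Pth HW)); rewrite dp.
    have := h2 h; rewrite h0' hd2 => /(_ isT); apply: le_trans.
    by rewrite addrAC subrr add0r (ger0_norm h0') mulrA -!mulrA (mulrC (N _)).
  have b3 : `|l (p (t + h)) z| <= e / 3.
    apply: (le_trans (lK _ _ Pth Hz)).
    have := h3 h; rewrite h0 hd3 => /(_ isT); rewrite ger0_norm ?(quasi_ge0 q)//.
    rewrite ltr_pdivlMr// => /ltW; apply: le_trans.
    by rewrite mulrC ler_wpM2l ?(quasi_ge0 q)// lerDl.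
  rewrite lU'.
  have -> : h * (l (p (t + h)) W + l (p (t + h)) z) + l (p (t + h)) U - l (p t) U =
    (l (p (t + h)) U - l (p t) U + h * l (p t) W) +
    (h * (l (p (t + h)) W - l (p t) W) + h * l (p (t + h)) z) by ring.
  apply: (le_trans (ler_normD _ _)).
  have -> : e * h = e / 3 * h + (h * (e / 3) + h * (e / 3)) by field.
  apply: lerD => //; apply: (le_trans (ler_normD _ _)).
  by apply: lerD; rewrite normrM (ger0_norm h0') ler_wpM2l.
Qed.
End SemigroupFacts.

(** * Depth and degrees in the tree *)
Section Tree.
Context {n : nat} (init : 'I_n.+1 -> 'I_n.+2) (hnet : tree_network init).
Local Open Scope nat_scope.

Lemma final_inj : injective (@final n).
Proof. exact: lift_inj. Qed.

(** The depth of a node is the number of steps to the root along the map sending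
each node to the start of the edge that ends there.  Its growth along the edges
is how the absence of cycles enters the argument. *)
Lemma tree_depth : exists depth : 'I_n.+2 -> nat,
  forall i, depth (final i) = (depth (init i)).+1.
Proof.
pose parent (m : 'I_n.+2) := if unlift ord0 m is Some i then init i else ord0.
have pf i : parent (final i) = init i by rewrite /parent /final liftK.
have ex m : exists k, iter k parent m == ord0.
  have /connectP[p pP ->] := network_oriented hnet m.
  elim/last_ind: p pP => [_|p x IH]; first by exists 0.
  rewrite rcons_path last_rcons => /andP[/IH[k kP] /existsP[i /andP[/eqP iP /eqP <-]]].
  by exists k.+1; rewrite iterSr pf iP.
exists (fun m => ex_minn (ex m)) => i.
case: ex_minnP => k kP kmin; case: ex_minnP => k' kP' kmin'.
case: k kP kmin => [/= /eqP h|k kP kmin];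
  first by have := neq_lift ord0 i; rewrite -/(final i) h eqxx.
congr (_.+1); apply/eqP; rewrite eqn_leq; apply/andP; split.
  by have := kmin k'.+1; rewrite iterSr pf => /(_ kP').
by apply: kmin'; move: kP; rewrite iterSr pf.
Qed.

Lemma init_neq_final i : init i != final i.
Proof.
have [depth hd] := tree_depth.
by apply/eqP => h; have := hd i; rewrite h => /eqP; rewrite -[X in X == _]addn0 -addn1 eqn_add2l.
Qed.

Lemma degreeE x : degree init x = #|[pred i | (init i == x) || (final i == x)]|.
Proof. by apply: eq_card => i; apply/idP/idP => [/set_mem|/mem_set]; rewrite inE. Qed.

(** The edge ending at a node is counted once, since it is not a loop. *)
Lemma degree_final i : degree init (final i) = #|[pred j | init j == final i]|.+1.
Proof.
rewrite degreeE (cardD1 i) inE eqxx orbT add1n; congr (_.+1).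
apply: eq_card => j; rewrite !inE (inj_eq final_inj).
by have [->|] := eqVneq j i; rewrite /= ?orbF// (negbTE (init_neq_final i)).
Qed.

Lemma multiple_final i j : init j = final i -> multiple_node init (final i).
Proof.
move=> ij; rewrite /multiple_node degree_final ltnS; apply/card_gt0P.
by exists j; rewrite inE ij.
Qed.

Lemma simple_or_multiple i : simple_node init (final i) \/ multiple_node init (final i).
Proof.
rewrite /simple_node /multiple_node degree_final.
by case: #|_| => [|k]; [left|right].
Qed.

Lemma init_root i : init i = ord0 -> i = ord0.
Proof.
move=> i0; have := network_root_simple hnet.
rewrite /simple_node degreeE => /eqP/eq_leq/card_le1P h.
have r k : init k = ord0 -> k \in [pred i | (init i == ord0) || (final i == ord0)].
  by move=> k0; rewrite inE k0 eqxx.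
have := h ord0 (r _ (network_first_edge hnet)) i.
by rewrite (r _ i0) inE => /esym/eqP.
Qed.

Lemma init_inner i : i != ord0 -> exists m, init i = final m.
Proof.
move=> i0; have : init i != ord0 by apply: contra i0 => /eqP/init_root/eqP.
by case: (unliftP ord0 (init i)) => [m ->|->]; [exists m|rewrite eqxx].
Qed.
End Tree.

(** * First-order expansion of primitives *)
Section Expansion.
Context {R : realType}.
Implicit Types (f g r : R -> R) (a b p k : R).
Local Notation mu := (@lebesgue_measure R).
Local Notation I := (`]0%R, 1%R[%classic : set R).

Lemma prim_cst k p : 0 <= p -> p <= 1 -> prim (cst k) p = k * p.
Proof.
move=> p0 p1.
have mp : measurable (`]0%R, p[%classic : set (measurableTypeR R)).
  exact: measurable_itv.
rewrite /prim (Rintegral_cst _ mp); congr (_ * _).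
have -> : p = fine p%:E by [].
congr fine; rewrite /= lebesgue_measure_itv/= lte_fin.
by case: ltP => [_|p0']; rewrite -?EFinB ?subr0//; congr EFin; apply/eqP; rewrite eq_le p0 p0'.
Qed.

Lemma prim_le g e a b : L2 g -> 0 <= a -> a <= b -> b <= 1 ->
  (forall t, a <= t <= b -> `|g t| <= e) -> `|prim g b - prim g a| <= e * (b - a).
Proof.
move=> Lg a0 ab b1 ge.
have e0 : 0 <= e by apply: le_trans (ge a _); rewrite ?lexx.
rewrite primB//.
have mJ : measurable (`]a, b[%classic : set (measurableTypeR R)) by exact: measurable_itv.
have gi : mu.-integrable `]a, b[ (EFin \o g) by apply: L2_integrable_sub => //; exact: itv_subI.
apply: (le_trans (le_normr_Rintegral mJ gi)).
have -> : e * (b - a) = \int[mu]_(x in `]a, b[) (cst e x).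
  rewrite -primB ?prim_cst//; [ring|lra|lra|exact: L2_cst].
apply: (le_Rintegral mJ); first exact: (integrable_norm gi).
  by apply: L2_integrable_sub (L2_cst e) mJ _; exact: itv_subI.
by move=> t; rewrite /= in_itv/= => /andP[ta tb]; apply: ge; rewrite !ltW.
Qed.

Lemma prim_expansion r p e : {within `[0%R, 1%R], continuous r} -> 0 <= p <= 1 -> 0 < e ->
  exists2 d, 0 < d & forall p', 0 <= p' <= 1 -> `|p' - p| < d ->
    `|prim r p' - prim r p - (p' - p) * r p| <= e * `|p' - p|.
Proof.
move=> cr p01 e0; have Lr := L2_continuous cr.
have /subspace_continuousP/(_ p)/= h := cr.
have /h/cvgrPdist_le/(_ e e0) : `[0%R, 1%R]%classic p by rewrite /= in_itv.
rewrite near_withinE => /nbhs_ballP[d /= d0 dr].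
exists d => // p' p'01 pd.
pose g t := r t - r p.
have Lg : L2 g by exact: L2B Lr (L2_cst _).
have gE s : 0 <= s <= 1 -> prim g s = prim r s - s * r p.
  move=> /andP[s0 s1].
  have := primD Lr (L2Z (-1) (L2_cst (r p))) s1.
  rewrite primZ ?prim_cst//; last exact: L2_cst.
  rewrite (_ : prim (fun t => r t + -1 * cst (r p) t) s = prim g s); first by move=> ->; ring.
  by apply: eq_Rintegral => t _; rewrite mulN1r.
have -> : prim r p' - prim r p - (p' - p) * r p = prim g p' - prim g p.
  by rewrite !gE//; ring.
have gle t : 0 <= t <= 1 -> `|t - p| < d -> `|g t| <= e.
  move=> t01 td; rewrite /g distrC; apply: dr; last by rewrite /= in_itv.
  by rewrite /ball/= distrC.
move/andP : p01 => [p0 p1]; move/andP : p'01 => [p'0 p'1].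
have [pp'|/ltW pp'] := leP p p'.
  rewrite [X in e * X]ger0_norm ?subr_ge0//; apply: prim_le => // t /andP[t1 t2].
  apply: gle; first by apply/andP; split; lra.
  by move: pd; rewrite !ltr_norml => /andP[? ?]; apply/andP; split; lra.
rewrite distrC [X in e * X]distrC [X in e * X]ger0_norm ?subr_ge0//.
apply: prim_le => // t /andP[t1 t2].
apply: gle; first by apply/andP; split; lra.
by move: pd; rewrite !ltr_norml => /andP[? ?]; apply/andP; split; lra.
Qed.

(** If r p were not 0, the primitive would vary at first order near p. *)
Lemma prim_const_eq0 r : {within `[0%R, 1%R], continuous r} ->
  (forall p, 0 <= p <= 1 -> prim r p = prim r 0) -> forall p, 0 <= p <= 1 -> r p = 0.
Proof.
move=> cr rc p p01; apply/eqP; rewrite -normr_le0; apply/ler_addgt0Pr => e e0; rewrite add0r.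
have [d d0 hd] := prim_expansion cr p01 e0.
pose d' := Num.min (d / 2) 2^-1.
have d'0 : 0 < d' by rewrite lt_min divr_gt0//= invr_gt0.
have d'd : d' < d by rewrite gt_min; apply/orP; left; lra.
have d'1 : d' <= 2^-1 by rewrite ge_min lexx orbT.
have [p' p'01 pp'] : exists2 p', 0 <= p' <= 1 & `|p' - p| = d'.
  have /andP[p0 p1] := p01.
  have [ph|ph] := leP p 2^-1.
    by exists (p + d'); [apply/andP; split; lra|rewrite addrAC subrr add0r gtr0_norm].
  by exists (p - d'); [apply/andP; split; lra|rewrite addrAC subrr add0r normrN gtr0_norm].
have := hd p' p'01; rewrite pp' => /(_ d'd).
by rewrite (rc p')// (rc p)// subrr sub0r normrN normrM pp' mulrC ler_pM2r.
Qed.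
End Expansion.

(** * Riemann invariants *)
Section Transport.
Context {R : realType} {n : nat}.
Context (init : 'I_n.+1 -> 'I_n.+2) (c : 'I_n.+1 -> R) (alpha : 'I_n.+2 -> R).
Context (hnet : tree_network init) (hc : forall i, 0 < c i).
Context (halpha : forall m, multiple_node init m -> alpha m = (degree init m)%:R - 2).
Context (S : R -> state R n -> state R n).
Local Notation H := (@stateH R n init).
Local Notation N := (@normH R n).
Context (hS : C0_semigroup H N S).
Context (hgen : forall U W, H U -> H W ->
  generator H N S U W <-> wave_operator init c alpha U W).
Implicit Types (U V : state R n) (i j m : 'I_n.+1) (b : bool) (t p : R).

Lemma quasi_normH : quasi_seminorm H N.
Proof.
split.
- by move=> a x y; exact: stateH_lin.
- exact: normH_ge0.
- exact: normH0.
- by move=> a x y; exact: (@normH_lin _ _ init).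
Qed.
Let q := quasi_normH.

(** [true] stands for motion away from the root, [false] for motion towards
it. *)
Definition dir b : R := if b then 1 else -1.
Definition entry b : R := if b then 0 else 1.

(** The integral, from the entry of the edge to p, of the invariant
v - dir b * c i * u_x.  The part in u_x is integrated explicitly, so that the
functional makes sense on every state. *)
Definition riemann i b p U : R :=
  prim (U.2 i) p - prim (U.2 i) (entry b) - dir b * c i * (U.1 i p - U.1 i (entry b)).

Lemma entry_itv b : 0 <= entry b <= 1.
Proof. by case: b; rewrite /= lexx ler01. Qed.

Lemma entry_dist b p : 0 <= p <= 1 -> `|p - entry b| <= 1.
Proof.
by move=> /andP[? ?]; case: b; rewrite /= ler_norml; apply/andP; split; lra.
Qed.

Lemma entryD_dist b p : 0 <= p <= 1 -> entry b + dir b * `|p - entry b| = p.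
Proof.
move=> /andP[? ?]; case: b => /=; first by rewrite subr0 ger0_norm// mul1r add0r.
by rewrite distrC ger0_norm ?subr_ge0//; ring.
Qed.

Lemma entryD_itv b z : 0 <= z <= 1 -> 0 <= entry b + dir b * z <= 1.
Proof. by move=> /andP[? ?]; case: b => /=; apply/andP; split; lra. Qed.

Lemma riemann_lin i b p a U V : 0 <= p <= 1 -> H U -> H V ->
  riemann i b p (a *: U + V) = a * riemann i b p U + riemann i b p V.
Proof.
move=> /andP[_ p1] [_ U2 _] [_ V2 _]; rewrite /riemann.
have e1 z : (a *: U + V).1 i z = a * U.1 i z + V.1 i z by [].
have e2 z : z <= 1 -> prim ((a *: U + V).2 i) z = a * prim (U.2 i) z + prim (V.2 i) z.
  move=> z1; rewrite -primZ//; exact: (primD (L2Z a (U2 i)) (V2 i) z1).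
have /andP[_ b1] := entry_itv b.
by rewrite !e1 !e2//; ring.
Qed.

Lemma riemann_lip i b p p' U : 0 <= p <= 1 -> 0 <= p' <= 1 -> H U ->
  `|riemann i b p' U - riemann i b p U| <= (1 + c i) * Num.sqrt `|p' - p| * N U.
Proof.
move=> p01 p'01 HU; rewrite /riemann.
have h1 := momentum_bound i HU p01 p'01; have h2 := displacement_bound i HU p01 p'01.
rewrite [X in `|X|](_ : _ = (prim (U.2 i) p' - prim (U.2 i) p) -
  dir b * c i * (U.1 i p' - U.1 i p)); last by ring.
apply: (le_trans (ler_normB _ _)).
rewrite -[leRHS]mulrA [leRHS]mulrDl mul1r; apply: lerD => //.
rewrite !normrM (gtr0_norm (hc i)).
have -> : `|dir b| = 1 by case: b; rewrite /= ?normrN normr1.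
by rewrite mul1r; apply: ler_wpM2l => //; exact: ltW.
Qed.

Lemma riemann_entry i b U : riemann i b (entry b) U = 0.
Proof. by rewrite /riemann !subrr mulr0 subr0. Qed.

Lemma riemann_bound i b p U : 0 <= p <= 1 -> H U -> `|riemann i b p U| <= (1 + c i) * N U.
Proof.
move=> p01 HU; have := riemann_lip i b (entry_itv b) p01 HU.
rewrite riemann_entry subr0 => h; apply: (le_trans h).
have c1 : 0 <= 1 + c i by rewrite addr_ge0// ltW.
rewrite -mulrA; apply: ler_wpM2l => //; apply: ler_piMl; first exact: normH_ge0.
rewrite -[leRHS]sqrtr1 ler_sqrt ?ler01//.
move/andP : p01 => [? ?]; case: b {h} => /=; rewrite ler_norml; apply/andP; split; lra.
Qed.

Lemma riemann_functional i b p : 0 <= p <= 1 -> bounded_functional H N (riemann i b p).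
Proof.
move=> p01; split; first by move=> a U V; exact: riemann_lin.
exists (1 + c i); first by rewrite addr_ge0// ltW.
by move=> U; exact: riemann_bound.
Qed.

Lemma mean_functional i : bounded_functional H N (fun U => prim (U.1 i) 1).
Proof.
split; last by exists 1 => // U HU; rewrite mul1r; exact: (mean_bound i HU).
move=> a U V [U1 _ _] [V1 _ _]; rewrite -primZ//; last exact: H1_L2.
exact: (primD (L2Z a (H1_L2 (U1 i))) (H1_L2 (V1 i)) (lexx 1)).
Qed.

Lemma increment_lin i p a U V :
  (a *: U + V).1 i p - (a *: U + V).1 i 0 =
  a * (U.1 i p - U.1 i 0) + (V.1 i p - V.1 i 0).
Proof.
have e1 z : (a *: U + V).1 i z = a * U.1 i z + V.1 i z by [].
by rewrite !e1; ring.
Qed.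

Lemma increment_functional i p : 0 <= p <= 1 ->
  bounded_functional H N (fun U => U.1 i p - U.1 i 0).
Proof.
move=> p01; split; first by move=> a U V _ _; exact: increment_lin.
exists 1 => // U HU; rewrite mul1r.
have z01 : 0 <= (0 : R) <= 1 by rewrite lexx ler01.
apply: (le_trans (displacement_bound i HU z01 p01)).
apply: ler_piMl; first exact: normH_ge0.
rewrite -[leRHS]sqrtr1 ler_sqrt ?ler01// subr0.
by case/andP : p01 => p0 p1; rewrite ger0_norm.
Qed.

(** * Transport along the characteristics, for data in the domain *)
Section Regular.
Context (x y : state R n) (gxy : generator H N S x y).

(** u, v, ux and uxx represent the orbit at time t, and (v, c^2 uxx) represents
its right derivative S t y. *)
Definition strong_form t (u v ux uxx : 'I_n.+1 -> R -> R) :=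
  [/\ wave_domain init c alpha u v ux uxx, same N (S t x) (u, v) &
      same N (S t y) (v, fun i z => c i ^+ 2 * uxx i z)].

Lemma strong_form_exists t : 0 <= t -> exists u v ux uxx, strong_form t u v ux uxx.
Proof.
move=> t0; have g := generator_S q hS t0 gxy; have [H1' H2 _] := g.
have [u [v [ux [uxx [h1 h2 h3]]]]] := (hgen H1' H2).1 g.
by exists u, v, ux, uxx.
Qed.

Definition invariant i b (v ux : 'I_n.+1 -> R -> R) p := v i p - dir b * c i * ux i p.

Definition quiet i b t := forall u v ux uxx, strong_form t u v ux uxx ->
  forall p, 0 <= p <= 1 -> invariant i b v ux p = 0.

Definition no_inflow i b t := forall u v ux uxx, strong_form t u v ux uxx ->
  invariant i b v ux (entry b) = 0.

Lemma dirK b : dir b * dir b = 1.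
Proof. by case: b; rewrite /= ?mulrNN mulr1. Qed.

Lemma strong_form_mem t u v ux uxx : strong_form t u v ux uxx -> H (u, v) /\
  H (v, fun i z => c i ^+ 2 * uxx i z).
Proof.
move=> [[D [cu cv] _ _ _] _ _]; split; split => //= i; have [h1 h2 h3 h4 h5] := D i => //.
  exact: H1_L2.
by apply: L2Z; case: h4.
Qed.

Lemma riemann_strong t u v ux uxx i b p : 0 <= t -> strong_form t u v ux uxx -> 0 <= p <= 1 ->
  riemann i b p (S t x) = prim (invariant i b v ux) p - prim (invariant i b v ux) (entry b).
Proof.
move=> t0 sf p01; have [HU _] := strong_form_mem sf; have [[D _ _ _ _] sU _] := sf.
have [Hx _ _] := gxy; have HSx := C0_stable hS t0 Hx.
rewrite (functional_same q (riemann_functional i b p01) HSx HU sU) /riemann /=.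
have [H1u wu H1ux _ H1v] := D i.
rewrite (wderiv_increment (proj1 H1u) wu (entry_itv b) p01).
have E z : 0 <= z <= 1 -> prim (invariant i b v ux) z =
    prim (v i) z - dir b * c i * prim (ux i) z.
  move=> /andP[_ z1]; have := primD (H1_L2 H1v) (L2Z (- (dir b * c i)) (H1_L2 H1ux)) z1.
  rewrite primZ//; last exact: H1_L2.
  rewrite mulNr => <-; apply: eq_Rintegral => s _.
  by rewrite /invariant mulNr.
by rewrite !E ?entry_itv//; ring.
Qed.

(** The transport equation r_t = - dir b * c i * r_x, integrated over the segment
from the entry to p. *)
Lemma riemann_strong_velocity t u v ux uxx i b p : 0 <= t ->
  strong_form t u v ux uxx -> 0 <= p <= 1 ->
  riemann i b p (S t y) =
  - (dir b * c i) * (invariant i b v ux p - invariant i b v ux (entry b)).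
Proof.
move=> t0 sf p01; have [_ HW] := strong_form_mem sf; have [[D _ _ _ _] _ sW] := sf.
have [_ Hy _] := gxy; have HSy := C0_stable hS t0 Hy.
rewrite (functional_same q (riemann_functional i b p01) HSy HW sW) /riemann /=.
have [_ _ H1ux wux H1v] := D i; have Lxx : L2 (uxx i) by case: wux.
have /andP[_ p1] := p01; have /andP[_ b1] := entry_itv b.
rewrite !primZ//.
have := wderiv_increment (proj1 H1ux) wux (entry_itv b) p01.
rewrite /invariant -mulrBr => <-.
have := dirK b; move: (dir b) => s ss.
rewrite [RHS](_ : _ = s * s * c i ^+ 2 * (ux i p - ux i (entry b)) -
  s * c i * (v i p - v i (entry b))); last by ring.
by rewrite ss mul1r.
Qed.

Lemma invariant_continuous t u v ux uxx i b : strong_form t u v ux uxx ->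
  {within `[0%R, 1%R], continuous (invariant i b v ux)}.
Proof.
move=> [[D _ _ _ _] _ _]; have [_ _ [cux _] _ [cv _]] := D i.
move=> z; apply: cvgB; first exact: cv.
by apply: cvgM; [exact: cvg_cst|exact: cux].
Qed.

(** The characteristic that reaches p at time t entered the edge at the time t0
below, after T, when the integral was over an empty segment.  Along the
characteristic the integral gains dir b * c i * r(p) from the motion of p and
loses the same amount, up to the inflow, by [riemann_strong_velocity]. *)
Lemma riemann_eq0 i b T t p : 0 <= T -> (forall s, T <= s -> no_inflow i b s) ->
  T + (c i)^-1 <= t -> 0 <= p <= 1 -> riemann i b p (S t x) = 0.
Proof.
move=> T0 hT Tt p01.
have c0 := hc i; have cV : 0 < (c i)^-1 by rewrite invr_gt0.
pose t0 := t - `|p - entry b| / c i.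
have pe := entry_dist b p01.
have Tt0 : T <= t0.
  have : `|p - entry b| / c i <= (c i)^-1 by rewrite ler_piMl// ltW.
  rewrite /t0; lra.
have t0t : t0 <= t by rewrite /t0 gerBl divr_ge0// ltW.
have t0_ge0 : 0 <= t0 by exact: le_trans Tt0.
have ct : c i * (t - t0) = `|p - entry b| by rewrite /t0; field; rewrite gt_eqF.
have E : entry b + dir b * c i * (t - t0) = p by rewrite -mulrA ct entryD_dist.
have := @moving_functional _ _ H N q S hS (riemann i b) (1 + c i) [set p | 0 <= p <= 1]
  x y (entry b) (dir b * c i) t0 t.
rewrite /= E subrr mulr0 addr0 riemann_entry; apply => //.
- by rewrite addr_ge0// ltW.
- by move=> z; exact: riemann_functional.
- by move=> z V; exact: riemann_bound.
- by move=> z z' V; exact: riemann_lip.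
- move=> s /andP[s0 s1].
  rewrite -mulrA; apply: entryD_itv; rewrite mulr_ge0 ?subr_ge0 ?(ltW c0)//=.
  by apply: le_trans pe; rewrite -ct ler_pM2l// lerB.
- move=> s t0s st e e0; have s_ge0 : 0 <= s by exact: le_trans t0s.
  have [u [v [ux [uxx sf]]]] := strong_form_exists s_ge0.
  have r0 := hT s (le_trans Tt0 t0s) _ _ _ _ sf.
  have path z : t0 <= z -> z <= t -> 0 <= entry b + dir b * c i * (z - t0) <= 1.
    move=> z0 z1; rewrite -mulrA; apply: entryD_itv; rewrite mulr_ge0 ?subr_ge0 ?(ltW c0)//=.
    by apply: le_trans pe; rewrite -ct ler_pM2l// lerB.
  have ps := path s t0s (ltW st).
  have ec : 0 < e / c i by rewrite divr_gt0.
  have [d d0 hd] := prim_expansion (@invariant_continuous s u v ux uxx i b sf) ps ec.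
  exists (d / c i); first by rewrite divr_gt0.
  move=> h /andP[h0 hd'] sh.
  have psh := path (s + h) ltac:(lra) sh.
  have dE : entry b + dir b * c i * (s + h - t0) - (entry b + dir b * c i * (s - t0)) =
    dir b * (c i * h) by ring.
  have ab : `|dir b * (c i * h)| = c i * h.
    rewrite normrM (gtr0_norm (mulr_gt0 c0 h0)).
    by case: (b); rewrite /= ?normrN normr1 mul1r.
  have chd : c i * h < d by rewrite mulrC -ltr_pdivlMr.
  have := hd _ psh; rewrite dE ab (mulrA (e / c i)) divfK ?gt_eqF// => /(_ chd) le.
  apply: le_trans le; rewrite le_eqVlt; apply/orP; left; apply/eqP; congr (`|_|).
  rewrite !(riemann_strong i b s_ge0 sf)// (riemann_strong_velocity i b s_ge0 sf)// r0 subr0.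
  ring.
Qed.


Lemma quiet_of_no_inflow i b T t : 0 <= T -> (forall s, T <= s -> no_inflow i b s) ->
  T + (c i)^-1 <= t -> quiet i b t.
Proof.
move=> T0 hT Tt u v ux uxx sf.
have t0 : 0 <= t.
  by apply: le_trans Tt; rewrite addr_ge0// invr_ge0 ltW.
have r0 p : 0 <= p <= 1 -> prim (invariant i b v ux) p = prim (invariant i b v ux) (entry b).
  move=> p01; apply/eqP; rewrite -subr_eq0 -(riemann_strong i b t0 sf p01).
  by rewrite (riemann_eq0 T0 hT Tt p01).
have z01 : 0 <= (0 : R) <= 1 by rewrite lexx ler01.
apply: prim_const_eq0; first exact: invariant_continuous sf.
by move=> p p01; rewrite (r0 p p01) (r0 0 z01).
Qed.

(** At an external node the transparent condition is the claim.  At an internal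
node the velocity v satisfies c_j u_jx = - v on each of the k - 1 outgoing edges;
the Kirchhoff law becomes - (k - 1) v - c u_x = - (k - 2) v. *)
Lemma no_inflow_up i t : (forall j, init j = final i -> quiet j false t) ->
  no_inflow i false t.
Proof.
move=> hq u v ux uxx sf; have [[_ [_ cv] hs _ hm] _ _] := sf.
rewrite /invariant /= mulN1r mulNr opprK.
case: (simple_or_multiple hnet i) => [si|mi]; first by rewrite hs//; ring.
have := hm i mi; rewrite (halpha mi) degree_final//.
rewrite (eq_bigr (fun=> - v i 1)); last first.
  move=> j /eqP ij; have := hq j ij _ _ _ _ sf 0.
  rewrite lexx ler01 => /(_ isT).
  rewrite /invariant /= mulN1r mulNr opprK (cv i j mi ij) => /eqP.
  by rewrite addrC addr_eq0 => /eqP.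
have -> : \sum_(j | init j == final i) - v i 1 =
    - (#|[pred j | init j == final i]|%:R * v i 1).
  by rewrite sumr_const mulNrn mulr_natl.
rewrite -natr1; move: (#|_|%:R : R) => k; lra.
Qed.

(** The same computation at the start of edge i, with the edge m that ends there
and the k - 2 siblings of i silent. *)
Lemma no_inflow_down i t : (forall m, init i = final m -> quiet m true t) ->
  (forall j, j != i -> init j = init i -> quiet j false t) -> no_inflow i true t.
Proof.
move=> hd hu u v ux uxx sf; have [[_ [_ cv] _ hr hm] _ _] := sf.
rewrite /invariant /= mul1r.
have [->|i0] := eqVneq i ord0; first by rewrite hr subrr.
have [m im] := init_inner hnet i0; have mm := multiple_final hnet im.
have := hd m im _ _ _ _ sf 1; rewrite lexx ler01 => /(_ isT).
rewrite /invariant /= mul1r => /eqP; rewrite subr_eq0 => /eqP vm.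
have := hm m mm; rewrite (halpha mm) degree_final// (bigD1 i) ?im//=.
rewrite (eq_bigr (fun=> - v m 1)); last first.
  move=> j /andP[/eqP jm ji]; have := hu j ji _ _ _ _ _ sf 0.
  rewrite lexx ler01 im => /(_ jm isT).
  rewrite /invariant /= mulN1r mulNr opprK (cv m j mm jm) => /eqP.
  by rewrite addrC addr_eq0 => /eqP.
rewrite (cv m i mm im) -vm (cardD1 i) inE im eqxx add1n.
have -> : \sum_(j | (init j == final m) && (j != i)) - v m 1 =
    - (#|[predD1 [pred j | init j == final m] & i]|%:R * v m 1).
  rewrite sumr_const mulNrn mulr_natl; congr (- (_ *+ _)).
  by apply: eq_card => j; rewrite !inE andbC.
rewrite -2!natr1; move: (#|_|%:R : R) => k; lra.
Qed.

Context (depth : 'I_n.+2 -> nat) (hdepth : forall i, depth (final i) = (depth (init i)).+1).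
Let tau : R := \sum_i (c i)^-1.
Let D := (\sum_i depth (init i))%N.

Lemma tau_ge i : (c i)^-1 <= tau.
Proof.
rewrite /tau (bigD1 i)//= lerDl; apply: sumr_ge0 => j _.
by rewrite invr_ge0 ltW.
Qed.

Lemma tau_ge0 : 0 <= tau.
Proof. by apply: sumr_ge0 => j _; rewrite invr_ge0 ltW. Qed.

Lemma depth_le i : (depth (init i) <= D)%N.
Proof. by rewrite /D (bigD1 i)//= leq_addr. Qed.

(** The edges that feed an upward signal on edge i are the children of i, which
are deeper.  No edge is deeper than D, which starts the induction. *)
Lemma quiet_up k i : (D < depth (init i) + k)%N -> forall t, k%:R * tau <= t -> quiet i false t.
Proof.
elim: k i => [|k IH] i; first by rewrite addn0 ltnNge depth_le.
rewrite addnS ltnS => Dk t.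
rewrite -natr1 mulrDl mul1r => kt.
apply: (@quiet_of_no_inflow i false (k%:R * tau)); first by rewrite mulr_ge0 ?tau_ge0.
  move=> s ks; apply: no_inflow_up => j ij; apply: IH ks.
  by rewrite ij hdepth addSn ltnS.
by apply: le_trans kt; rewrite lerD2l tau_ge.
Qed.

(** A downward signal is fed by the parent edge, which is less deep, and by
upward signals on the siblings, already silent. *)
Lemma quiet_down k i : (depth (init i) < k)%N ->
  forall t, D.+1%:R * tau + k%:R * tau <= t -> quiet i true t.
Proof.
elim: k i => [//|k IH] i; rewrite ltnS => dk t.
rewrite -(natr1 k) mulrDl mul1r addrA => kt.
have kt0 := tau_ge0.
apply: (@quiet_of_no_inflow i true (D.+1%:R * tau + k%:R * tau)).
- by rewrite addr_ge0 ?mulr_ge0.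
- move=> s ks; apply: no_inflow_down => [m im|j _ _].
    by apply: IH ks; rewrite im hdepth in dk.
  apply: (@quiet_up D.+1); first by rewrite addnS ltnS leq_addl.
  by apply: le_trans ks; rewrite lerDl mulr_ge0.
- by apply: le_trans kt; rewrite lerD2l tau_ge.
Qed.

Definition extinction_time : R := D.+1%:R * tau + D.+1%:R * tau.

Lemma extinction_time_ge0 : 0 <= extinction_time.
Proof. by rewrite addr_ge0 ?mulr_ge0 ?tau_ge0. Qed.

Lemma strong_form_extinct t u v ux uxx i p : extinction_time <= t ->
  strong_form t u v ux uxx -> 0 <= p <= 1 -> v i p = 0 /\ ux i p = 0.
Proof.
move=> Tt sf p01.
have h1 : D.+1%:R * tau <= t.
  by apply: le_trans Tt; rewrite lerDl mulr_ge0 ?tau_ge0.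
have := @quiet_up D.+1 i ltac:(by rewrite addnS ltnS leq_addl) t h1 _ _ _ _ sf p p01.
have := @quiet_down D.+1 i ltac:(by rewrite ltnS depth_le) t Tt _ _ _ _ sf p p01.
rewrite /invariant /= mul1r mulN1r mulNr => e1 e2.
have v0 : v i p = 0 by lra.
split => //; apply/eqP; have : c i * ux i p == 0 by apply/eqP; lra.
by rewrite mulf_eq0 gt_eqF.
Qed.

Lemma increment_extinct t i p : extinction_time <= t -> 0 <= p <= 1 ->
  (S t x).1 i p - (S t x).1 i 0 = 0.
Proof.
move=> Tt p01; have t0 := le_trans extinction_time_ge0 Tt.
have [u [v [ux [uxx sf]]]] := strong_form_exists t0.
have [HU _] := strong_form_mem sf; have [[DD _ _ _ _] sU _] := sf.
have [Hx _ _] := gxy; have HSx := C0_stable hS t0 Hx.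
rewrite (functional_same q (increment_functional i p01) HSx HU sU) /=.
have z01 : 0 <= (0 : R) <= 1 by rewrite lexx ler01.
have [H1u wu _ _ _] := DD i; rewrite (wderiv_increment (proj1 H1u) wu z01 p01) prim0 subr0.
rewrite /prim (@eq_Rintegral _ _ _ _ _ (cst 0)); first by rewrite /Rintegral integral0.
move=> z; rewrite inE/= in_itv/= => /andP[z0 zp].
have /andP[_ p1] := p01.
have z01' : 0 <= z <= 1 by rewrite ltW//= (le_trans (ltW zp)).
by have [_ ->] := strong_form_extinct i Tt sf z01'.
Qed.

Lemma mean_extinct t i : extinction_time <= t ->
  prim ((S t x).1 i) 1 = prim ((S extinction_time x).1 i) 1.
Proof.
move=> Tt.
have := @moving_functional _ _ H N q S hS (fun _ U => prim (U.1 i) 1) 1 setT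
  x y 0 0 extinction_time t.
apply => //.
- by move=> p _; exact: mean_functional.
- by move=> p z _ Hz; rewrite mul1r; exact: (mean_bound i Hz).
- by move=> p p' z _ _ _; rewrite subrr normr0 mul1r mulr_ge0 ?sqrtr_ge0 ?normH_ge0.
- exact: extinction_time_ge0.
- move=> s Ts st e e0; exists 1 => // h /andP[h0 _] _.
  rewrite subrr add0r.
  have s0 := le_trans extinction_time_ge0 Ts.
  have [u [v [ux [uxx sf]]]] := strong_form_exists s0.
  have [_ HW] := strong_form_mem sf; have [_ _ sW] := sf.
  have [_ Hy _] := gxy; have HSy := C0_stable hS s0 Hy.
  rewrite (functional_same q (mean_functional i) HSy HW sW) /=.
  rewrite /prim (@eq_Rintegral _ _ _ _ _ (cst 0)).
    by rewrite /Rintegral integral0 mulr0 normr0 mulr_ge0// ltW.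
  move=> z; rewrite inE/= in_itv/= => /andP[z0 z1].
  have [-> _] := @strong_form_extinct _ _ _ _ _ i z Ts sf ltac:(by rewrite !ltW).
  by [].
Qed.
End Regular.

(** * From the domain to all finite-energy data *)

(** Bounded functionals are determined by their values on a dense set. *)
Lemma functional_eq_dense (l l' : state R n -> R) U : bounded_functional H N l ->
  bounded_functional H N l' -> H U ->
  (forall x y, generator H N S x y -> l x = l' x) -> l U = l' U.
Proof.
move=> bl bl' HU ll'.
have [_ [K K0 hK]] := bl; have [_ [K' K'0 hK']] := bl'.
apply/eqP; rewrite -subr_eq0 -normr_le0; apply/ler_addgt0Pr => e e0; rewrite add0r.
have KK : 0 < K + K' + 1 by rewrite ltr_wpDl// addr_ge0.
have eK : 0 < e / (K + K' + 1) by rewrite divr_gt0.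
have [V [W [HV HW VW]]] := domain_dense c alpha HU eK.
have /hgen gVW := VW; have {gVW}VV' := ll' _ _ (gVW HV HW).
rewrite ltr_pdivlMr// => /ltW le; apply: le_trans le.
have HUV := quasi_memB q HU HV.
have -> : l U - l' U = l (U - V) - l' (U - V).
  by rewrite (functionalB bl HU HV) (functionalB bl' HU HV) VV'; ring.
apply: (le_trans (ler_normB _ _)); apply: (le_trans (lerD (hK _ HUV) (hK' _ HUV))).
by rewrite -mulrDl mulrC ler_wpM2l ?normH_ge0// lerDl.
Qed.

Context (depth : 'I_n.+2 -> nat) (hdepth : forall i, depth (final i) = (depth (init i)).+1).
Let T := extinction_time depth.

Lemma constant_edge_mean U i : H U -> (forall p, 0 <= p <= 1 -> U.1 i p - U.1 i 0 = 0) ->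
  forall p, 0 <= p <= 1 -> U.1 i p = prim (U.1 i) 1.
Proof.
move=> HU U0 p p01.
have E z : 0 <= z <= 1 -> U.1 i z = U.1 i 0 by move=> /U0/eqP; rewrite subr_eq0 => /eqP.
rewrite E// -[LHS]mulr1 -(prim_cst (U.1 i 0) ler01 (lexx 1)).
apply: eq_Rintegral => z; rewrite inE/= in_itv/= => /andP[z0 z1].
by rewrite E// !ltW.
Qed.

(** On each edge, displacement increments vanish and the mean of u no longer
changes: both are bounded functionals of the initial state.  Continuity at the
nodes then propagates the constant of the root edge by induction on depth. *)
Lemma trajectory_constant (U : R -> state R n) : trajectory H N S U ->
  exists C : R, forall i p t, 0 <= p <= 1 -> T <= t -> (U t).1 i p = C.
Proof.
move=> hU; have T0 : 0 <= T := extinction_time_ge0 depth.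
have [HU0 _] := hU 0 (lexx 0).
have HSU t : 0 <= t -> H (S t (U 0)) by move=> t0; exact: (C0_stable hS).
have inc t i p : T <= t -> 0 <= p <= 1 -> (U t).1 i p - (U t).1 i 0 = 0.
  move=> Tt p01; have t0 := le_trans T0 Tt; have [HUt sUt] := hU t t0.
  rewrite (functional_same q (increment_functional i p01) HUt (HSU t t0) sUt).
  have bl := increment_functional i p01.
  have b0 : bounded_functional H N (fun=> 0).
    by split => [*|]; [rewrite mulr0 addr0|exists 0 => // *; rewrite normr0 mul0r].
  apply: (functional_eq_dense (functional_S q hS t0 bl) b0 HU0) => x y gxy.
  exact: (increment_extinct gxy hdepth).
have mean t i : T <= t -> prim ((U t).1 i) 1 = prim ((U T).1 i) 1.
  move=> Tt; have t0 := le_trans T0 Tt; have [HUt sUt] := hU t t0.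
  have [HUT sUT] := hU T T0; have bl := mean_functional i.
  rewrite (functional_same q bl HUt (HSU t t0) sUt).
  rewrite (functional_same q bl HUT (HSU T T0) sUT).
  apply: (functional_eq_dense (functional_S q hS t0 bl) (functional_S q hS T0 bl) HU0).
  by move=> x y gxy; exact: (mean_extinct gxy hdepth).
have val t i p : T <= t -> 0 <= p <= 1 -> (U t).1 i p = prim ((U T).1 i) 1.
  move=> Tt p01; rewrite -(mean t i Tt); apply: constant_edge_mean => //.
    by have [] := hU t (le_trans T0 Tt).
  by move=> z; exact: inc.
exists (prim ((U T).1 ord0) 1) => i p t p01 Tt; rewrite val//.
have [[_ _ cn] _] := hU T T0.
have z01 : 0 <= (0 : R) <= 1 by rewrite lexx ler01.
have o01 : 0 <= (1 : R) <= 1 by rewrite lexx ler01.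
have [k] := ubnP (depth (init i)).
elim: k i => // k IH i; rewrite ltnS => ik.
have [->//|i0] := eqVneq i ord0.
have [m im] := init_inner hnet i0.
have := cn m i (multiple_final hnet im) im.
rewrite !val// => ->; apply: IH; by rewrite im hdepth in ik.
Qed.
End Transport.

Theorem theorem1 (R : realType) (n : nat) (init : 'I_n.+1 -> 'I_n.+2)
  (c : 'I_n.+1 -> R) (alpha : 'I_n.+2 -> R) (U : R -> state R n)
  (hnet : tree_network init)
  (hc : forall i, 0 < c i)
  (halpha : forall m, multiple_node init m -> alpha m = (degree init m)%:R - 2)
  (hU : wave_solution init c alpha U) :
  exists T C : R, 0 <= T /\
    forall i (x t : R), 0 <= x <= 1 -> T <= t -> (U t).1 i x = C.
Proof.
have [S [hS hgen] htraj] := hU.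
have [depth hdepth] := tree_depth hnet.
have [C hC] := trajectory_constant hnet hc halpha hS hgen hdepth htraj.
exists (extinction_time init c depth), C; split; first exact: extinction_time_ge0.
by move=> i x t; exact: hC.
Qed.
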